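(* Let $A, B \subseteq \omega$ with $B$ infinite, and suppose that $A$ is c.e. relative to every infinite subset of $B$. Suppose moreover that either (a) $\omega_1^B = \omega_1^{\mathrm{ck}}$, or (b) $A$ is infinite and $A$ is c.e. relative to every infinite subset of $A$. Then there is an infinite $C \subseteq B$ and a single Turing functional $\Phi$ such that $\Phi(S) = A$ for every infinite $S \subseteq C$.
   Context: $\omega_1^B$ is the least ordinal not computable relative to $B$ (the least non-$B$-computable ordinal), and $\omega_1^{\mathrm{ck}}$ is the least non-computable ordinal. *)

(* Defs.v *)
From Stdlib Require Import List Arith.
Import ListNotations.

Definition set_infinite (X : nat -> bool) : Prop :=
  forall m, exists n, m <= n /\ X n = true.

Definition subset (X Y : nat -> bool) : Prop :=
  forall n, X n = true -> Y n = true.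

(* Codes of oracle mu-recursive functionals (= Turing functionals). *)
Inductive code : Type :=
| Zero : code
| Succ : code
| Proj : nat -> code
| Orac : code
| Comp : code -> list code -> code
| Rec  : code -> code -> code
| Mu   : code -> code.

Inductive eval (X : nat -> bool) : code -> list nat -> nat -> Prop :=
| ev_zero args : eval X Zero args 0
| ev_succ x args : eval X Succ (x :: args) (S x)
| ev_proj i args x : nth_error args i = Some x -> eval X (Proj i) args x
| ev_orac x args : eval X Orac (x :: args) (if X x then 1 else 0)
| ev_comp f gs args ys y :
    evalList X gs args ys -> eval X f ys y -> eval X (Comp f gs) args y
| ev_rec0 f g args y : eval X f args y -> eval X (Rec f g) (0 :: args) y
| ev_recS f g n args r y :
    eval X (Rec f g) (n :: args) r -> eval X g (n :: r :: args) y ->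
    eval X (Rec f g) (S n :: args) y
| ev_mu f args n :
    eval X f (n :: args) 0 ->
    (forall m, m < n -> exists k, eval X f (m :: args) (S k)) ->
    eval X (Mu f) args n
with evalList (X : nat -> bool) : list code -> list nat -> list nat -> Prop :=
| evl_nil args : evalList X [] args []
| evl_cons g gs args y ys :
    eval X g args y -> evalList X gs args ys -> evalList X (g :: gs) args (y :: ys).

Definition ce_in (X A : nat -> bool) : Prop :=
  exists e : code, forall n, A n = true <-> exists y, eval X e [n] y.

Definition computes (X : nat -> bool) (Phi : code) (A : nat -> bool) : Prop :=
  forall n, eval X Phi [n] (if A n then 1 else 0).

(* Well-orderings coded as reflexive relations on nat (field = {a | R a a}). *)
Definition field (R : nat -> nat -> Prop) (a : nat) : Prop := R a a.

Definition is_well_order (R : nat -> nat -> Prop) : Prop :=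
  (forall a b, R a b -> field R a /\ field R b) /\
  (forall a b, R a b -> R b a -> a = b) /\
  (forall a b c, R a b -> R b c -> R a c) /\
  (forall a b, field R a -> field R b -> R a b \/ R b a) /\
  well_founded (fun a b => R a b /\ a <> b).

Definition comp_well_order (X : nat -> bool) (R : nat -> nat -> Prop) : Prop :=
  is_well_order R /\
  exists e : code, forall a b,
      (R a b -> eval X e [a; b] 1) /\ (~ R a b -> eval X e [a; b] 0).

Definition order_iso (R1 R2 : nat -> nat -> Prop) : Prop :=
  exists f : nat -> nat,
    (forall a, field R1 a -> field R2 (f a)) /\
    (forall a b, field R1 a -> field R1 b -> (R1 a b <-> R2 (f a) (f b))) /\
    (forall c, field R2 c -> exists a, field R1 a /\ f a = c).

Definition empty_oracle : nat -> bool := fun _ => false.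

(* omega_1^B = omega_1^ck : every B-computable ordinal (order type of a
   B-computable well-ordering) is a computable ordinal. *)
Definition omega1_eq_ck (B : nat -> bool) : Prop :=
  forall R, comp_well_order B R ->
    exists R', comp_well_order empty_oracle R' /\ order_iso R R'.

(* Main.v *)
From Stdlib Require Import List Arith Lia Bool Classical ClassicalEpsilon Cantor.
Require Import Defs.
Import ListNotations.

(** Call a finite set h an n-witness if some fixed functional with an oracle between a stem and
    the stem united with h converges on n. A forcing argument over the closed classes of
    infinite subsets of B makes this enumeration uniform: at some condition neither a wrong
    convergence nor an infinite set avoiding a witness for some n in A can be added, so for all
    sets X in the class, n lies in A iff X has a finite subset which is an n-witness. "Having
    a witness" is monotone in X, so passing to subsets never hurts.

    It remains to bound, from a sparse subset S, how far one must look for a witness of n.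

    (a) The finite sets that could still avoid the witnesses of some n in A form a B-computable
    well-founded tree; by hypothesis its Kleene-Brouwer order embeds in a computable well-order
    R. If S is so sparse that each element exceeds the names in R of all nodes below its
    predecessor, then the greedy R-descent through S dominates the ranks along S, so n is not
    in A once the descent is exhausted without a witness.

    (b) By the Galvin-Prikry theorem one may assume that, for all n and m in A, whether
    the even samples of X reach a witness for n no later than the odd samples reach one for m
    does not depend on X. If for some m this holds for infinitely many n in A, these n form an
    infinite set H computable from every S; A is c.e. in H and the gaps of S bound the stages.
    Otherwise every large n in A found by S bounds the search for a witness of m. *)

(** A uniform enumeration of [A] becomes a computation once the search for a witness is bounded, and
    a thin set can dominate functions that it does not compute. Fusion produces such sets: each
    element may be required to exceed any number attached to the finite part before it. This is why
    the isomorphism in (a) may be arbitrary, whereas [R] must be computable without oracle: a subset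
    [S] cannot be expected to compute [B] or the tree, but it can run a descent through [R].

    In (b) the outcomes of the comparisons are not given effectively either; homogeneity makes each
    of them readable from every infinite subset. Only finitely many pairs can be settled at one
    element, so an outcome is read above an element that bounds both [n] and [m]. *)

(** * Least numbers and bounded search *)

Definition mu (p : nat -> bool) : nat :=
  epsilon (inhabits 0) (fun n => p n = true /\ forall m, m < n -> p m = false).

Lemma least_exists (p : nat -> bool) :
  (exists n, p n = true) ->
  exists n, p n = true /\ forall m, m < n -> p m = false.
Proof.
  intros [n Hn]. induction n as [n IH] using lt_wf_ind.
  destruct (classic (exists m, m < n /\ p m = true)) as [[m [Hm Hp]]|H].
  - exact (IH m Hm Hp).
  - exists n. split; [exact Hn|]. intros m Hm.
    destruct (p m) eqn:E; [|reflexivity]. exfalso. apply H. now exists m.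
Qed.

Lemma mu_spec p : (exists n, p n = true) ->
  p (mu p) = true /\ forall m, m < mu p -> p m = false.
Proof.
  intros H. unfold mu. apply epsilon_spec. now apply least_exists.
Qed.

Lemma mu_eq p n : p n = true -> (forall m, m < n -> p m = false) -> mu p = n.
Proof.
  intros H1 H2. destruct (mu_spec p (ex_intro _ n H1)) as [H3 H4].
  destruct (lt_eq_lt_dec (mu p) n) as [[H|H]|H]; auto.
  - rewrite H2 in H3; congruence.
  - rewrite H4 in H1; congruence.
Qed.

Lemma mu_le p n : p n = true -> mu p <= n.
Proof.
  intros H. destruct (mu_spec p (ex_intro _ n H)) as [_ H2].
  destruct (le_lt_dec (mu p) n); auto. rewrite H2 in H; auto; discriminate.
Qed.

(** The value [k] means that no number below [k] satisfies [p]. The recursion is written with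
    [nat_rect], the shape that [comp_rec] recognizes. *)
Definition bmin (k : nat) (p : nat -> bool) : nat :=
  nat_rect (fun _ => nat) 0
    (fun i r => if r <? i then r else if p i then i else S i) k.

Lemma bmin_spec k p :
  (bmin k p < k /\ p (bmin k p) = true /\ forall m, m < bmin k p -> p m = false) \/
  (bmin k p = k /\ forall m, m < k -> p m = false).
Proof.
  induction k as [|k IH]; [right; split; [reflexivity|lia]|].
  change (bmin (S k) p) with
    (if bmin k p <? k then bmin k p else if p k then k else S k).
  destruct IH as [[H1 [H2 H3]]|[H1 H2]].
  - left. apply Nat.ltb_lt in H1 as H1'. rewrite H1'. repeat split; auto; lia.
  - rewrite H1, Nat.ltb_irrefl. destruct (p k) eqn:E.
    + left. repeat split; auto.
    + right. split; auto. intros m Hm.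
      destruct (Nat.eq_dec m k); [now subst|apply H2; lia].
Qed.

Definition bex (k : nat) (p : nat -> bool) : bool := bmin k p <? k.
Definition ball (k : nat) (p : nat -> bool) : bool :=
  negb (bex k (fun x => negb (p x))).

Lemma bex_spec k p : bex k p = true <-> exists x, x < k /\ p x = true.
Proof.
  unfold bex. rewrite Nat.ltb_lt. destruct (bmin_spec k p) as [[H1 [H2 _]]|[H1 H2]].
  - split; [|auto]. intros _. eauto.
  - split; [lia|]. intros [x [Hx Hp]]. rewrite H2 in Hp; auto; discriminate.
Qed.

Lemma ball_spec k p : ball k p = true <-> forall x, x < k -> p x = true.
Proof.
  unfold ball. rewrite negb_true_iff, <- not_true_iff_false, bex_spec. split.
  - intros H x Hx. destruct (p x) eqn:E; auto. exfalso. apply H.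
    exists x. now rewrite E.
  - intros H [x [Hx Hp]]. rewrite H in Hp; auto; discriminate.
Qed.

(** * Uniformly computable functions *)

Section Computable.
Variable Cl : (nat -> bool) -> Prop.

(** One code has to serve all oracles in [Cl]. The class is a parameter because the unbounded
    searches below terminate only on suitable oracles, such as the infinite subsets of a given
    set. *)
Definition comp (n : nat) (f : (nat -> bool) -> list nat -> nat) : Prop :=
  exists c, forall X v, Cl X -> length v = n -> eval X c v (f X v).

Definition compl (n m : nat) (L : (nat -> bool) -> list nat -> list nat) : Prop :=
  exists cs, forall X v, Cl X -> length v = n ->
    length (L X v) = m /\ evalList X cs v (L X v).

Definition compb (n : nat) (p : (nat -> bool) -> list nat -> bool) : Prop :=
  comp n (fun X v => Nat.b2n (p X v)).

Lemma comp_ext n f g :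
  (forall X v, Cl X -> length v = n -> f X v = g X v) -> comp n f -> comp n g.
Proof.
  intros H [c Hc]. exists c. intros X v HX Hv. rewrite <- H; auto.
Qed.

Lemma compb_ext n f g :
  (forall X v, Cl X -> length v = n -> f X v = g X v) -> compb n f -> compb n g.
Proof.
  intros H. apply comp_ext. intros. now rewrite H.
Qed.

Lemma comp_nth n i : i < n -> comp n (fun X v => nth i v 0).
Proof.
  intros Hi. exists (Proj i). intros X v _ Hv. constructor.
  apply nth_error_nth'. lia.
Qed.

Lemma comp_tl n i (L : list nat -> list nat) :
  comp n (fun X v => nth (S i) (L v) 0) -> comp n (fun X v => nth i (tl (L v)) 0).
Proof.
  apply comp_ext. intros X v _ _. destruct (L v); [now destruct i|reflexivity].
Qed.

Lemma compl_nil n : compl n 0 (fun X v => []).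
Proof. exists []. intros. split; [reflexivity|constructor]. Qed.

Lemma compl_cons n m f L :
  comp n f -> compl n m L -> compl n (S m) (fun X v => f X v :: L X v).
Proof.
  intros [c Hc] [cs Hcs]. exists (c :: cs). intros X v HX Hv.
  destruct (Hcs X v HX Hv). split; [simpl; lia|]. constructor; auto.
Qed.

Lemma compl_app n m1 m2 L1 L2 :
  compl n m1 L1 -> compl n m2 L2 -> compl n (m1 + m2) (fun X v => L1 X v ++ L2 X v).
Proof.
  intros [c1 H1] [c2 H2]. exists (c1 ++ c2). intros X v HX Hv.
  destruct (H1 X v HX Hv) as [E1 F1]. destruct (H2 X v HX Hv) as [E2 F2].
  split; [rewrite length_app; lia|]. clear E1 H1.
  induction F1; simpl; [exact F2|constructor; auto].
Qed.

Lemma compl_ext n m f g :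
  (forall X v, Cl X -> length v = n -> f X v = g X v) -> compl n m f -> compl n m g.
Proof.
  intros H [c Hc]. exists c. intros X v HX Hv. rewrite <- H; auto.
Qed.

Lemma compl_skipn j m : compl (j + m) m (fun X v => skipn j v).
Proof.
  remember (j + m) as n eqn:E. revert j E.
  induction m as [|m IH]; intros j E.
  - apply compl_ext with (fun X v => []); [|apply compl_nil].
    intros X v _ Hv. rewrite skipn_all2; auto; lia.
  - apply compl_ext with (fun X v => nth j v 0 :: skipn (S j) v).
    + intros X v _ Hv. assert (H : j < length v) by lia. clear - H.
      revert j H. induction v as [|x v IH]; intros j H; simpl in H; [lia|].
      destruct j; [reflexivity|]. simpl nth. rewrite !skipn_cons. apply IH. lia.
    + apply compl_cons; [apply comp_nth; lia|apply IH; lia].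
Qed.

Lemma compl_id n : compl n n (fun X v => v).
Proof. exact (compl_skipn 0 n). Qed.

Lemma comp_comp n m h L :
  comp m h -> compl n m L -> comp n (fun X v => h X (L X v)).
Proof.
  intros [c Hc] [cs Hcs]. exists (Comp c cs). intros X v HX Hv.
  destruct (Hcs X v HX Hv). econstructor; eauto.
Qed.

Lemma comp_app1 n h f :
  comp 1 (fun X v => h X (nth 0 v 0)) -> comp n f -> comp n (fun X v => h X (f X v)).
Proof.
  intros Hh Hf.
  exact (comp_comp n 1 _ _ Hh (compl_cons _ _ _ _ Hf (compl_nil n))).
Qed.

Lemma comp_app2 n h f g :
  comp 2 (fun X v => h X (nth 0 v 0) (nth 1 v 0)) -> comp n f -> comp n g ->
  comp n (fun X v => h X (f X v) (g X v)).
Proof.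
  intros Hh Hf Hg.
  exact (comp_comp n 2 _ _ Hh
    (compl_cons _ _ _ _ Hf (compl_cons _ _ _ _ Hg (compl_nil n)))).
Qed.

Lemma comp_const n k : comp n (fun X v => k).
Proof.
  induction k as [|k [c Hc]].
  - exists Zero. intros. constructor.
  - exists (Comp Succ [c]). intros X v HX Hv.
    apply ev_comp with [k]; [|constructor]. constructor; [auto|constructor].
Qed.

Lemma comp_S n f : comp n f -> comp n (fun X v => S (f X v)).
Proof.
  intros [c Hc]. exists (Comp Succ [c]). intros X v HX Hv.
  apply ev_comp with [f X v]; [|constructor]. constructor; [auto|constructor].
Qed.

Lemma compb_oracle n f : comp n f -> compb n (fun X v => X (f X v)).
Proof.
  intros [c Hc]. exists (Comp Orac [c]). intros X v HX Hv.
  apply ev_comp with [f X v]; [constructor; [auto|constructor]|].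
  replace (Nat.b2n (X (f X v))) with (if X (f X v) then 1 else 0)
    by (now destruct (X (f X v))).
  constructor.
Qed.

Lemma comp_rec n k a b :
  comp n k -> comp n a ->
  comp (S (S n)) (fun X w => b X (tl (tl w)) (nth 0 w 0) (nth 1 w 0)) ->
  comp n (fun X v => nat_rect (fun _ => nat) (a X v) (fun i r => b X v i r) (k X v)).
Proof.
  intros Hk [ca Ha] [cb Hb].
  apply comp_comp with (m := S n)
    (h := fun X w => nat_rect (fun _ => nat) (a X (tl w))
                       (fun i r => b X (tl w) i r) (nth 0 w 0))
    (L := fun X v => k X v :: v).
  - exists (Rec ca cb). intros X [|j v] HX Hv; [discriminate|].
    injection Hv as Hv. simpl. induction j as [|j IH]; simpl.
    + constructor. auto.
    + econstructor; [exact IH|].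
      apply (Hb X (j :: _ :: v) HX). simpl. now rewrite Hv.
  - apply compl_cons; [exact Hk|apply compl_id].
Qed.

Lemma comp_mu n p :
  compb (S n) (fun X w => p X (tl w) (nth 0 w 0)) ->
  (forall X v, Cl X -> length v = n -> exists x, p X v x = true) ->
  comp n (fun X v => mu (p X v)).
Proof.
  intros Hp Hex.
  (* [Mu] looks for a zero, so the truth value of [p] is reversed. *)
  assert (Hq : comp (S n) (fun X w =>
     nat_rect (fun _ => nat) 1 (fun _ _ => 0) (Nat.b2n (p X (tl w) (nth 0 w 0))))).
  { apply comp_rec with (a := fun _ _ => 1) (b := fun _ _ _ _ => 0);
      [exact Hp|apply comp_const..]. }
  destruct Hq as [c Hc]. exists (Mu c). intros X v HX Hv.
  destruct (mu_spec _ (Hex X v HX Hv)) as [H1 H2].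
  constructor.
  - assert (E := Hc X (mu (p X v) :: v) HX). simpl in E. rewrite H1 in E.
    apply E. now rewrite Hv.
  - intros m Hm. exists 0. assert (E := Hc X (m :: v) HX). simpl in E.
    rewrite H2 in E by auto. apply E. now rewrite Hv.
Qed.

Lemma comp_if n p f g :
  compb n p -> comp n f -> comp n g -> comp n (fun X v => if p X v then f X v else g X v).
Proof.
  intros Hp Hf Hg.
  (* The truth value is the recursion argument: zero rounds give [g], one round gives [f]. *)
  apply comp_ext with (fun X v =>
     nat_rect (fun _ => nat) (g X v) (fun _ _ => f X v) (Nat.b2n (p X v))).
  - intros X v _ _. now destruct (p X v).
  - apply comp_rec with (a := g) (b := fun X v _ _ => f X v); auto.
    generalize (comp_comp _ _ _ _ Hf (compl_skipn 2 n)). apply comp_ext.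
    intros X [|x [|y w]]; reflexivity.
Qed.

Lemma comp_b2n n p : compb n p -> comp n (fun X v => Nat.b2n (p X v)).
Proof. exact (fun H => H). Qed.

Lemma compb_const n b : compb n (fun X v => b).
Proof. apply (comp_const n (Nat.b2n b)). Qed.

Lemma compb_if n p q r :
  compb n p -> compb n q -> compb n r ->
  compb n (fun X v => if p X v then q X v else r X v).
Proof.
  intros Hp Hq Hr. generalize (comp_if _ _ _ _ Hp Hq Hr). apply comp_ext.
  intros X v _ _. now destruct (p X v).
Qed.

Lemma compb_neg n p : compb n p -> compb n (fun X v => negb (p X v)).
Proof. intros H. apply (compb_if n p _ _ H); apply compb_const. Qed.

Lemma compb_and n p q : compb n p -> compb n q -> compb n (fun X v => p X v && q X v).
Proof. intros Hp Hq. apply (compb_if n p q _ Hp Hq). apply compb_const. Qed.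

Lemma compb_or n p q : compb n p -> compb n q -> compb n (fun X v => p X v || q X v).
Proof. intros Hp Hq. apply (compb_if n p _ q Hp); auto. apply compb_const. Qed.

End Computable.

Ltac comp_var :=
  lazymatch goal with
  | |- comp _ _ (fun X v => nth ?i v 0) => apply comp_nth; lia
  | |- comp _ _ (fun X v => nth ?i (tl (@?L v)) 0) =>
      apply (comp_tl _ _ i L); cbv beta; comp_var
  end.

Create HintDb comp discriminated.
#[export] Hint Extern 1 (comp _ _ (fun _ v => nth _ _ _)) => comp_var : comp.
#[export] Hint Extern 5 (comp _ _ (fun _ _ => ?k)) => apply comp_const : comp.
#[export] Hint Extern 5 (compb _ _ (fun _ _ => ?k)) => apply compb_const : comp.
#[export] Hint Resolve comp_S compb_oracle comp_b2n compb_neg compb_and compb_or : comp.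
#[export] Hint Extern 2 (comp _ _ (fun _ _ => if _ then _ else _)) => eapply comp_if : comp.
#[export] Hint Extern 2 (compb _ _ (fun _ _ => if _ then _ else _)) => eapply compb_if : comp.
#[export] Hint Extern 2 (comp _ _ (fun _ _ => nat_rect _ _ _ _)) =>
   eapply comp_rec; cbv beta : comp.

(** Works on the syntactic shape of a function, which is why later definitions keep to [nat_rect],
    [bmin], [bex], [ball] and [mask]. *)
Ltac comp_auto := auto 40 with comp.

Section Arithmetic.
Variable Cl : (nat -> bool) -> Prop.
Variable n : nat.
Notation comp := (comp Cl n).
Notation compb := (compb Cl n).

Lemma comp_pred f : comp f -> comp (fun X v => pred (f X v)).
Proof.
  intros H. apply comp_ext with (fun X v => nat_rect (fun _ => nat) 0 (fun i _ => i) (f X v)).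
  - intros. now destruct (f X v).
  - comp_auto.
Qed.
Hint Resolve comp_pred : comp.

Lemma comp_add f g : comp f -> comp g -> comp (fun X v => f X v + g X v).
Proof.
  intros Hf Hg. apply comp_ext with
    (fun X v => nat_rect (fun _ => nat) (g X v) (fun _ r => S r) (f X v)).
  - intros X v _ _. induction (f X v); simpl; auto.
  - comp_auto.
Qed.

End Arithmetic.
#[export] Hint Resolve comp_pred comp_add : comp.

Section MoreArithmetic.
Variable Cl : (nat -> bool) -> Prop.
Variable n : nat.
Notation comp := (comp Cl n).
Notation compb := (compb Cl n).

Lemma comp_sub f g : comp f -> comp g -> comp (fun X v => f X v - g X v).
Proof.
  intros Hf Hg. apply comp_ext with
    (fun X v => nat_rect (fun _ => nat) (f X v) (fun _ r => pred r) (g X v)).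
  - intros X v _ _. induction (g X v); simpl; lia.
  - comp_auto.
Qed.
Hint Resolve comp_sub : comp.

Lemma comp_pow2 f : comp f -> comp (fun X v => 2 ^ f X v).
Proof.
  intros Hf. apply comp_ext with
    (fun X v => nat_rect (fun _ => nat) 1 (fun _ r => r + r) (f X v)).
  - intros X v _ _. induction (f X v); simpl; lia.
  - comp_auto.
Qed.

Lemma compb_leb f g : comp f -> comp g -> compb (fun X v => f X v <=? g X v).
Proof.
  intros Hf Hg. apply comp_ext with
    (fun X v => nat_rect (fun _ => nat) 1 (fun _ _ => 0) (f X v - g X v)).
  - intros X v _ _. destruct (f X v - g X v) eqn:E; simpl.
    + rewrite (proj2 (Nat.leb_le _ _)); [reflexivity|lia].
    + rewrite (proj2 (Nat.leb_gt _ _)); [reflexivity|lia].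
  - comp_auto.
Qed.
Hint Resolve compb_leb : comp.

Lemma compb_ltb f g : comp f -> comp g -> compb (fun X v => f X v <? g X v).
Proof. intros Hf Hg. apply (compb_leb (fun X v => S (f X v)) g); comp_auto. Qed.

Lemma compb_eqb f g : comp f -> comp g -> compb (fun X v => f X v =? g X v).
Proof.
  intros Hf Hg. apply compb_ext with
    (fun X v => (f X v <=? g X v) && (g X v <=? f X v)); [|comp_auto].
  intros X v _ _. apply eq_iff_eq_true.
  rewrite andb_true_iff, !Nat.leb_le, Nat.eqb_eq. lia.
Qed.

End MoreArithmetic.
#[export] Hint Resolve comp_sub comp_pow2 compb_leb compb_ltb compb_eqb : comp.

Section BoundedSearch.
Variable Cl : (nat -> bool) -> Prop.
Variable n : nat.

Lemma comp_bmin k p :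
  comp Cl n k -> compb Cl (S n) (fun X w => p X (tl w) (nth 0 w 0)) ->
  comp Cl n (fun X v => bmin (k X v) (p X v)).
Proof.
  intros Hk Hp. unfold bmin. eapply comp_rec; [exact Hk|comp_auto|cbv beta].
  assert (Hs : compl Cl (S (S n)) (S n) (fun X w => nth 0 w 0 :: skipn 2 w)).
  { apply compl_cons; [comp_auto|exact (compl_skipn Cl 2 n)]. }
  generalize (comp_comp _ _ _ _ _ Hp Hs). intros Hq.
  apply comp_ext with (g := fun X v => Nat.b2n (p X (tl (tl v)) (nth 0 v 0))) in Hq;
    [|intros X [|x [|y v]] _ H; try discriminate; reflexivity].
  change (compb Cl (S (S n)) (fun X v => p X (tl (tl v)) (nth 0 v 0))) in Hq.
  comp_auto.
Qed.

Lemma compb_bex k p :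
  comp Cl n k -> compb Cl (S n) (fun X w => p X (tl w) (nth 0 w 0)) ->
  compb Cl n (fun X v => bex (k X v) (p X v)).
Proof.
  intros Hk Hp. apply compb_ltb; [|exact Hk]. now apply comp_bmin.
Qed.

Lemma compb_ball k p :
  comp Cl n k -> compb Cl (S n) (fun X w => p X (tl w) (nth 0 w 0)) ->
  compb Cl n (fun X v => ball (k X v) (p X v)).
Proof.
  intros Hk Hp. apply compb_neg.
  apply (compb_bex k (fun X v x => negb (p X v x))); comp_auto.
Qed.

End BoundedSearch.
#[export] Hint Extern 2 (comp _ _ (fun _ _ => bmin _ _)) => eapply comp_bmin; cbv beta : comp.
#[export] Hint Extern 2 (compb _ _ (fun _ _ => bex _ _)) => eapply compb_bex; cbv beta : comp.
#[export] Hint Extern 2 (compb _ _ (fun _ _ => ball _ _)) => eapply compb_ball; cbv beta : comp.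

(** * Finite sets as bit masks *)

(** In this form halving, and with it the bit test, is computable by bounded search. *)
Lemma div2_bmin m : Nat.div2 m = bmin (S m) (fun q => m <=? q + q + 1).
Proof.
  assert (Hm := Nat.div2_odd m).
  assert (Hb : Nat.b2n (Nat.odd m) <= 1) by (destruct (Nat.odd m); simpl; lia).
  destruct (bmin_spec (S m) (fun q => m <=? q + q + 1)) as [[H1 [H2 H3]]|[H1 H2]].
  - apply Nat.leb_le in H2.
    destruct (le_lt_dec (bmin (S m) (fun q => m <=? q + q + 1)) (Nat.div2 m)) as [H|H]; [lia|].
    specialize (H3 _ H). apply Nat.leb_gt in H3. lia.
  - specialize (H2 (Nat.div2 m)). rewrite Nat.leb_gt in H2. lia.
Qed.

Lemma testbit_pow2_add m k x :
  m < 2 ^ k -> Nat.testbit (m + 2 ^ k) x = if x =? k then true else Nat.testbit m x.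
Proof.
  intros H.
  assert (Hb : forall y, k <= y -> Nat.testbit m y = false).
  { intros y Hy. destruct (Nat.eq_dec m 0) as [->|H0]; [apply Nat.bits_0|].
    apply Nat.bits_above_log2. apply Nat.log2_lt_pow2; [lia|].
    apply Nat.lt_le_trans with (2 ^ k); auto. apply Nat.pow_le_mono_r; lia. }
  rewrite Nat.add_nocarry_lxor.
  - rewrite Nat.lxor_spec, Nat.pow2_bits_eqb, (Nat.eqb_sym k x).
    destruct (Nat.eqb_spec x k) as [->|Hx].
    + now rewrite Hb.
    + apply xorb_false_r.
  - apply Nat.bits_inj_0. intros y. rewrite Nat.land_spec, Nat.pow2_bits_eqb.
    destruct (Nat.eqb_spec k y) as [->|Hy]; [rewrite Hb; auto|apply andb_false_r].
Qed.

Lemma testbit_high m k x : m < 2 ^ k -> k <= x -> Nat.testbit m x = false.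
Proof.
  intros Hm Hx. destruct (Nat.eq_dec m 0) as [->|H0]; [apply Nat.bits_0|].
  apply Nat.bits_above_log2. apply Nat.log2_lt_pow2; [lia|].
  apply Nat.lt_le_trans with (2 ^ k); auto. apply Nat.pow_le_mono_r; lia.
Qed.

Lemma testbit_lt m x : Nat.testbit m x = true -> x < m.
Proof.
  intros H. destruct (le_lt_dec m x) as [Hx|Hx]; auto.
  rewrite (testbit_high m m) in H; auto; try discriminate.
  apply Nat.pow_gt_lin_r. lia.
Qed.

Fixpoint mask (X : nat -> bool) (v : nat) : nat :=
  match v with
  | 0 => 0
  | S v => mask X v + (if X v then 2 ^ v else 0)
  end.

Lemma mask_lt X v : mask X v < 2 ^ v.
Proof. induction v; simpl; [lia|]. destruct (X v); lia. Qed.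

Lemma testbit_mask X v x : Nat.testbit (mask X v) x = (x <? v) && X x.
Proof.
  induction v as [|v IH]; [apply Nat.bits_0|]. cbn [mask].
  assert (Hc : (x <? S v) = (x <? v) || (x =? v)).
  { apply eq_iff_eq_true. rewrite orb_true_iff, !Nat.ltb_lt, Nat.eqb_eq. lia. }
  rewrite Hc. destruct (X v) eqn:E.
  - rewrite testbit_pow2_add by apply mask_lt. rewrite IH.
    destruct (Nat.eqb_spec x v) as [->|Hx].
    + now rewrite E, orb_true_r.
    + now rewrite orb_false_r.
  - rewrite Nat.add_0_r, IH. destruct (Nat.eqb_spec x v) as [->|Hx].
    + now rewrite E, !andb_false_r.
    + now rewrite orb_false_r.
Qed.

Lemma bits_ext a b : (forall x, Nat.testbit a x = Nat.testbit b x) -> a = b.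
Proof. apply Nat.bits_inj. Qed.

Lemma mask_ext X Y v : (forall x, x < v -> X x = Y x) -> mask X v = mask Y v.
Proof.
  intros H. apply bits_ext. intros x. rewrite !testbit_mask.
  destruct (Nat.ltb_spec x v); [now rewrite H|reflexivity].
Qed.

Definition bsub (g h : nat) : Prop :=
  forall x, Nat.testbit g x = true -> Nat.testbit h x = true.

(** A search over all subsets of [h] may therefore be bounded by the number [h]. *)
Lemma bsub_le g h : bsub g h -> g <= h.
Proof.
  intros H. apply Nat.ldiff_le. apply Nat.bits_inj_0. intros x.
  rewrite Nat.ldiff_spec. destruct (Nat.testbit g x) eqn:E; auto.
  now rewrite (H x E).
Qed.

Section Bits.
Variable Cl : (nat -> bool) -> Prop.
Variable n : nat.

Lemma compb_testbit f g :
  comp Cl n f -> comp Cl n g -> compb Cl n (fun X v => Nat.testbit (f X v) (g X v)).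
Proof.
  apply (comp_app2 Cl n (fun X a b => Nat.b2n (Nat.testbit a b))).
  change (compb Cl 2 (fun X v => Nat.testbit (nth 0 v 0) (nth 1 v 0))).
  apply compb_ext with (fun X v =>
    let s := nat_rect (fun _ => nat) (nth 0 v 0)
      (fun _ r => bmin (S r) (fun q => r <=? q + q + 1)) (nth 1 v 0) in
    let d := bmin (S s) (fun q => s <=? q + q + 1) in
    s =? d + d + 1); [|cbv zeta; comp_auto].
  intros X v _ _. cbv zeta. rewrite <- div2_bmin.
  assert (E : forall i, nat_rect (fun _ => nat) (nth 0 v 0)
      (fun _ r => bmin (S r) (fun q => r <=? q + q + 1)) i = Nat.shiftr (nth 0 v 0) i).
  { induction i as [|i IH]; [reflexivity|].
    cbn [nat_rect]. rewrite IH, <- div2_bmin. reflexivity. }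
  rewrite E.
  replace (Nat.testbit (nth 0 v 0) (nth 1 v 0))
    with (Nat.odd (Nat.shiftr (nth 0 v 0) (nth 1 v 0)))
    by now rewrite <- Nat.bit0_odd, Nat.shiftr_spec'.
  generalize (Nat.shiftr (nth 0 v 0) (nth 1 v 0)). intros m.
  assert (Hm := Nat.div2_odd m). destruct (Nat.odd m); simpl Nat.b2n in Hm.
  - apply Nat.eqb_eq. lia.
  - apply Nat.eqb_neq. lia.
Qed.

Lemma comp_mask p f :
  comp Cl n f -> compb Cl (S n) (fun X w => p X (tl w) (nth 0 w 0)) ->
  comp Cl n (fun X v => mask (p X v) (f X v)).
Proof.
  intros Hf Hp. apply comp_ext with (fun X v => nat_rect (fun _ => nat) 0
    (fun i r => r + if p X v i then 2 ^ i else 0) (f X v)).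
  - intros X v _ _. induction (f X v); simpl; auto.
  - assert (Hs : compl Cl (S (S n)) (S n) (fun X w => nth 0 w 0 :: skipn 2 w)).
    { apply compl_cons; [comp_auto|exact (compl_skipn Cl 2 n)]. }
    generalize (comp_comp _ _ _ _ _ Hp Hs). intros Hq.
    apply comp_ext with (g := fun X v => Nat.b2n (p X (tl (tl v)) (nth 0 v 0))) in Hq;
      [|intros X [|x [|y v]] _ H; try discriminate; reflexivity].
    change (compb Cl (S (S n)) (fun X v => p X (tl (tl v)) (nth 0 v 0))) in Hq.
    comp_auto.
Qed.

End Bits.
#[export] Hint Resolve compb_testbit : comp.
#[export] Hint Extern 2 (comp _ _ (fun _ _ => mask _ _)) => eapply comp_mask; cbv beta : comp.

(** * Bounded evaluation *)

(* The value [y] is returned as [S y], and [0] means divergence: queries and searches are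
   cut off at [t]. *)
Fixpoint evn (t : nat) (O : nat -> bool) (e : code) (args : list nat) {struct e} : nat :=
  match e with
  | Zero => 1
  | Succ => match args with [] => 0 | x :: _ => S (S x) end
  | Proj i => match nth_error args i with Some x => S x | None => 0 end
  | Orac => match args with
            | [] => 0
            | x :: _ => if x <? t then S (Nat.b2n (O x)) else 0
            end
  | Comp f gs =>
      (fix go (l : list code) (acc : list nat) : nat :=
         match l with
         | [] => evn t O f (rev acc)
         | g :: l => let y := evn t O g args in
                     if y =? 0 then 0 else go l (pred y :: acc)
         end) gs []
  | Rec f g =>
      match args with
      | [] => 0
      | n :: a => nat_rect (fun _ => nat) (evn t O f a)
                    (fun i r => if r =? 0 then 0 else evn t O g (i :: pred r :: a)) n
      end
  | Mu f =>
      let i := bmin t (fun i => evn t O f (i :: args) <=? 1) in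
      if i <? t then if evn t O f (i :: args) =? 1 then S i else 0 else 0
  end.

Definition evl (t : nat) (O : nat -> bool) (f : code) (args : list nat) :=
  fix go (l : list code) (acc : list nat) : nat :=
         match l with
         | [] => evn t O f (rev acc)
         | g :: l => let y := evn t O g args in
                     if y =? 0 then 0 else go l (pred y :: acc)
         end.

Lemma evn_comp t O f gs args : evn t O (Comp f gs) args = evl t O f args gs [].
Proof. reflexivity. Qed.

(** The generated principle gives no hypothesis for the codes in the list of [Comp]. *)
Lemma code_nested_ind (P : code -> Prop) :
  P Zero -> P Succ -> (forall i, P (Proj i)) -> P Orac ->
  (forall f gs, P f -> Forall P gs -> P (Comp f gs)) ->
  (forall f g, P f -> P g -> P (Rec f g)) -> (forall f, P f -> P (Mu f)) ->
  forall e, P e.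
Proof.
  intros H0 H1 H2 H3 H4 H5 H6. fix IH 1.
  intros [ | | i | | f gs | f g | f ].
  - exact H0.
  - exact H1.
  - apply H2.
  - exact H3.
  - apply H4; [apply IH|].
    induction gs as [|g gs IHgs]; constructor; [apply IH|exact IHgs].
  - apply H5; apply IH.
  - apply H6; apply IH.
Qed.

Lemma bmin_eq k p n :
  n < k -> p n = true -> (forall m, m < n -> p m = false) -> bmin k p = n.
Proof.
  intros Hn Hp Hm. destruct (bmin_spec k p) as [[H1 [H2 H3]]|[H1 H2]].
  - destruct (lt_eq_lt_dec (bmin k p) n) as [[H|H]|H]; auto.
    + rewrite Hm in H2; [discriminate|auto].
    + rewrite H3 in Hp; [discriminate|auto].
  - rewrite H2 in Hp; [discriminate|auto].
Qed.

Lemma evn_mu t O f args n :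
  evn t O (Mu f) args = S n <->
  n < t /\ evn t O f (n :: args) = 1 /\
  forall m, m < n -> exists k, evn t O f (m :: args) = S (S k).
Proof.
  cbn [evn]. cbv zeta. split.
  - destruct (bmin_spec t (fun i => evn t O f (i :: args) <=? 1)) as [[H1 [H2 H3]]|[H1 H2]].
    + rewrite (proj2 (Nat.ltb_lt _ _) H1).
      destruct (Nat.eqb_spec (evn t O f
        (bmin t (fun i => evn t O f (i :: args) <=? 1) :: args)) 1) as [E|E]; [|discriminate].
      injection 1 as <-. split; [auto|]. split; [auto|].
      intros m Hm. specialize (H3 m Hm). apply Nat.leb_gt in H3.
      exists (evn t O f (m :: args) - 2). lia.
    + rewrite H1, Nat.ltb_irrefl. discriminate.
  - intros [H1 [H2 H3]].
    rewrite (bmin_eq t (fun i => evn t O f (i :: args) <=? 1) n).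
    + rewrite (proj2 (Nat.ltb_lt _ _) H1), H2. reflexivity.
    + exact H1.
    + now rewrite H2.
    + intros m Hm. destruct (H3 m Hm) as [k ->]. reflexivity.
Qed.

Lemma evn_sound t O X e : (forall x, x < t -> X x = O x) ->
  forall args y, evn t O e args = S y -> eval X e args y.
Proof.
  intros HX. induction e as [ | | i | | f gs IHf IHgs | f g IHf IHg | f IHf ]
    using code_nested_ind; intros args y H.
  - injection H as <-. constructor.
  - destruct args; [discriminate|]. injection H as <-. constructor.
  - cbn in H. destruct (nth_error args i) eqn:E; [|discriminate].
    injection H as <-. now constructor.
  - destruct args as [|x args]; [discriminate|]. cbn -[Nat.ltb] in H.
    destruct (Nat.ltb_spec x t) as [Hx|Hx]; [|discriminate].
    injection H as <-. rewrite <- HX by auto.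
    replace (Nat.b2n (X x)) with (if X x then 1 else 0) by now destruct (X x).
    constructor.
  - rewrite evn_comp in H.
    assert (HG : forall l acc, Forall (fun g => forall args y,
        evn t O g args = S y -> eval X g args y) l ->
        evl t O f args l acc = S y ->
        exists ys, evalList X l args ys /\ evn t O f (rev acc ++ ys) = S y).
    { induction l as [|g l IHl]; intros acc Hl HH.
      - exists []. split; [constructor|]. now rewrite app_nil_r.
      - inversion Hl as [|? ? Hg Hl']; subst. cbn [evl] in HH.
        destruct (Nat.eqb_spec (evn t O g args) 0) as [E|E]; [discriminate|].
        apply IHl in HH; [|exact Hl']. destruct HH as [ys [H1 H2]].
        exists (pred (evn t O g args) :: ys). split.
        + constructor; [apply Hg; lia|exact H1].
        + cbn [rev] in H2. rewrite <- app_assoc in H2. exact H2. }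
    destruct (HG gs [] IHgs H) as [ys [H1 H2]].
    econstructor; [exact H1|]. apply IHf. exact H2.
  - destruct args as [|n args]; [discriminate|]. cbn [evn] in H. revert y H.
    induction n as [|n IH]; intros y H; cbn [nat_rect] in H.
    + constructor. auto.
    + destruct (Nat.eqb_spec (nat_rect (fun _ => nat) (evn t O f args)
            (fun i r => if r =? 0 then 0 else evn t O g (i :: pred r :: args)) n) 0)
        as [E|E]; [discriminate|].
      econstructor; [apply IH|apply IHg, H]. lia.
  - apply evn_mu in H. destruct H as [H1 [H2 H3]]. constructor; [auto|].
    intros m Hm. destruct (H3 m Hm) as [k Hk]. exists k. auto.
Qed.

(** A computation cut off at [t] has asked only about numbers below [t], so it survives any change
    of the oracle above. *)
Lemma evn_mono t t' O O' e : t <= t' -> (forall x, x < t -> O x = O' x) ->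
  forall args y, evn t O e args = S y -> evn t' O' e args = S y.
Proof.
  intros Ht HX. induction e as [ | | i | | f gs IHf IHgs | f g IHf IHg | f IHf ]
    using code_nested_ind; intros args y H; auto.
  - destruct args as [|x args]; [discriminate|]. cbn -[Nat.ltb] in *.
    destruct (Nat.ltb_spec x t) as [Hx|Hx]; [|discriminate].
    rewrite (proj2 (Nat.ltb_lt x t')) by lia. now rewrite <- HX.
  - rewrite evn_comp in *. revert H. generalize (@nil nat). intros acc.
    revert acc. induction IHgs as [|g l Hg Hl IHl]; intros acc HH; cbn [evl] in *.
    + now apply IHf.
    + destruct (evn t O g args) as [|z] eqn:E; [discriminate|].
      rewrite (Hg _ _ E). cbn [Nat.eqb pred] in *. auto.
  - destruct args as [|n args]; [discriminate|]. cbn [evn] in *. revert y H.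
    induction n as [|n IH]; intros y H; cbn [nat_rect] in *; auto.
    destruct (nat_rect (fun _ => nat) (evn t O f args)
            (fun i r => if r =? 0 then 0 else evn t O g (i :: pred r :: args)) n)
      as [|z] eqn:E; [discriminate|].
    rewrite (IH z eq_refl). cbn [Nat.eqb pred] in *. auto.
  - apply evn_mu in H. destruct H as [H1 [H2 H3]]. apply evn_mu.
    split; [lia|]. split; [auto|].
    intros m Hm. destruct (H3 m Hm) as [k Hk]. exists k. auto.
Qed.

Lemma bounded_choice_mono (P : nat -> nat -> Prop) n :
  (forall m t t', t <= t' -> P m t -> P m t') ->
  (forall m, m < n -> exists t, P m t) -> exists t, forall m, m < n -> P m t.
Proof.
  intros Hm H. induction n as [|n IH]; [exists 0; lia|].
  destruct IH as [t Ht]; [intros; apply H; lia|].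
  destruct (H n) as [t' Ht']; [lia|]. exists (t + t'). intros m Hlt.
  destruct (Nat.eq_dec m n) as [->|]; [apply Hm with t'|apply Hm with t]; auto; try lia.
  apply Ht. lia.
Qed.

Lemma eval_complete X e args y :
  eval X e args y -> exists t, evn t X e args = S y
with evalList_complete X gs args ys :
  evalList X gs args ys -> exists t, Forall2 (fun g y => evn t X g args = S y) gs ys.
Proof.
  - intros H.
    destruct H as [args|x args|i args x Hx|x args|f gs args ys y Hgs Hf|f g args y Hf
      |f g n args r y Hr Hg|f args n H0 Hlt].
    + exists 0. reflexivity.
    + exists 0. reflexivity.
    + exists 0. cbn. now rewrite Hx.
    + exists (S x). cbn -[Nat.ltb]. rewrite (proj2 (Nat.ltb_lt x (S x))) by lia.
      now destruct (X x).
    + destruct (eval_complete _ _ _ _ Hf) as [tf Htf].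
      destruct (evalList_complete _ _ _ _ Hgs) as [t Ht].
      exists (tf + t). rewrite evn_comp.
      assert (HE : forall acc,
        evl (tf + t) X f args gs acc = evn (tf + t) X f (rev acc ++ ys)).
      { clear - Ht. induction Ht as [|g z gs ys Hg _ IHt]; intros acc; cbn [evl].
        - now rewrite app_nil_r.
        - assert (E : evn (tf + t) X g args = S z) by (apply evn_mono with t X; auto; lia).
          rewrite E. cbn [Nat.eqb pred]. rewrite IHt. cbn [rev].
          now rewrite <- app_assoc. }
      rewrite HE. apply evn_mono with tf X; auto; lia.
    + destruct (eval_complete _ _ _ _ Hf) as [tf Htf]. exists tf. exact Htf.
    + destruct (eval_complete _ _ _ _ Hr) as [t1 H1].
      destruct (eval_complete _ _ _ _ Hg) as [t2 H2].
      exists (t1 + t2).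
      apply evn_mono with (t' := t1 + t2) (O' := X) in H1; [|lia|auto].
      apply evn_mono with (t' := t1 + t2) (O' := X) in H2; [|lia|auto].
      cbn [evn nat_rect] in *. rewrite H1. cbn [Nat.eqb pred]. exact H2.
    + destruct (eval_complete _ _ _ _ H0) as [t0 Ht0].
      destruct (bounded_choice_mono
        (fun m t => exists k, evn t X f (m :: args) = S (S k)) n) as [t1 Ht1].
      * intros m t t' Ht [k Hk]. exists k. apply evn_mono with t X; auto.
      * intros m Hm. destruct (Hlt m Hm) as [k Hk].
        destruct (eval_complete _ _ _ _ Hk) as [t Ht]. exists t, k. exact Ht.
      * exists (S n + t0 + t1). apply evn_mu. split; [lia|]. split.
        -- apply evn_mono with t0 X; auto; lia.
        -- intros m Hm. destruct (Ht1 m Hm) as [k Hk]. exists k.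
           apply evn_mono with t1 X; auto; lia.
  - intros H. destruct H as [args|g gs args y ys Hg Hgs].
    + exists 0. constructor.
    + destruct (eval_complete _ _ _ _ Hg) as [t1 Ht1].
      destruct (evalList_complete _ _ _ _ Hgs) as [t2 Ht2].
      exists (t1 + t2). constructor.
      * apply evn_mono with t1 X; auto; lia.
      * revert Ht2. apply Forall2_impl. intros a b.
        apply evn_mono; auto; lia.
Qed.

Lemma comp_evn_app Cl e n k T G L :
  comp Cl (S (S k)) (fun X v =>
    evn (nth 0 v 0) (Nat.testbit (nth 1 v 0)) e (tl (tl v))) ->
  comp Cl n T -> comp Cl n G -> compl Cl n k L ->
  comp Cl n (fun X v => evn (T X v) (Nat.testbit (G X v)) e (L X v)).
Proof.
  intros He HT HG HL.
  exact (comp_comp _ _ _ _ _ He (compl_cons _ _ _ _ _ HT (compl_cons _ _ _ _ _ HG HL))).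
Qed.

(** The code [e] is fixed, so an induction on [e] suffices and no universal functional has to be
    built. Stage and finite oracle are the first two arguments. *)
Lemma comp_evn Cl e k :
  comp Cl (S (S k)) (fun X v =>
    evn (nth 0 v 0) (Nat.testbit (nth 1 v 0)) e (tl (tl v))).
Proof.
  assert (Hargs : forall k, compl Cl (S (S k)) k (fun X v => tl (tl v))).
  { clear. intros k. eapply compl_ext; [|exact (compl_skipn Cl 2 k)].
    intros X [|x [|y v]]; reflexivity. }
  revert k. induction e as [ | | i | | f gs IHf IHgs | f g IHf IHg | f IHf ]
    using code_nested_ind; intros k.
  - cbn [evn]. comp_auto.
  - destruct k as [|k].
    + apply comp_ext with (fun X v => 0); [|comp_auto].
      intros X [|x [|y [|z v]]] _ H; try discriminate; reflexivity.
    + apply comp_ext with (fun X v => S (S (nth 2 v 0))); [|comp_auto].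
      intros X [|x [|y [|z v]]] _ H; try discriminate; reflexivity.
  - destruct (le_lt_dec k i) as [Hi|Hi].
    + apply comp_ext with (fun X v => 0); [|comp_auto].
      intros X [|x [|y v]] _ H; try discriminate. cbn in *.
      rewrite (proj2 (nth_error_None v i)); [reflexivity|lia].
    + apply comp_ext with (fun X v => S (nth (S (S i)) v 0)); [|comp_auto].
      intros X [|x [|y v]] _ H; try discriminate. cbn in *.
      rewrite (nth_error_nth' v 0); [reflexivity|lia].
  - destruct k as [|k].
    + apply comp_ext with (fun X v => 0); [|comp_auto].
      intros X [|x [|y [|z v]]] _ H; try discriminate; reflexivity.
    + apply comp_ext with (fun X v => if nth 2 v 0 <? nth 0 v 0
        then S (Nat.b2n (Nat.testbit (nth 1 v 0) (nth 2 v 0))) else 0); [|comp_auto].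
      intros X [|x [|y [|z v]]] _ H; try discriminate; reflexivity.
  - assert (HG : forall l acc m, Forall (fun g => forall k, comp Cl (S (S k))
        (fun X v => evn (nth 0 v 0) (Nat.testbit (nth 1 v 0)) g (tl (tl v)))) l ->
        compl Cl (S (S k)) m (fun X v => rev (acc X v)) ->
        comp Cl (S (S k)) (fun X v =>
          evl (nth 0 v 0) (Nat.testbit (nth 1 v 0)) f (tl (tl v)) l (acc X v))).
    { induction l as [|g l IHl]; intros acc m Hl Hacc.
      - cbn [evl].
        assert (Hc : compl Cl (S (S k)) (S (S m))
           (fun X v => nth 0 v 0 :: nth 1 v 0 :: rev (acc X v))).
        { apply compl_cons; [comp_auto|]. apply compl_cons; [comp_auto|exact Hacc]. }
        exact (comp_comp _ _ _ _ _ (IHf m) Hc).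
      - inversion Hl as [|? ? Hg Hl']; subst. specialize (Hg k).
        cbn [evl]. cbv zeta.
        apply (comp_if Cl _ (fun X v =>
          evn (nth 0 v 0) (Nat.testbit (nth 1 v 0)) g (tl (tl v)) =? 0)
          (fun _ _ => 0)); [comp_auto|comp_auto|].
        apply (IHl (fun X v =>
          pred (evn (nth 0 v 0) (Nat.testbit (nth 1 v 0)) g (tl (tl v))) :: acc X v)
          (S m)); [exact Hl'|].
        cbn [rev]. rewrite <- (Nat.add_1_r m). apply compl_app; [exact Hacc|].
        apply compl_cons; [comp_auto|apply compl_nil]. }
    apply (HG gs (fun _ _ => []) 0 IHgs). apply compl_nil.
  - destruct k as [|k].
    + apply comp_ext with (fun X v => 0); [|comp_auto].
      intros X [|x [|y [|z v]]] _ H; try discriminate; reflexivity.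
    + apply comp_ext with (fun X v => nat_rect (fun _ => nat)
        (evn (nth 0 v 0) (Nat.testbit (nth 1 v 0)) f (skipn 3 v))
        (fun i r => if r =? 0 then 0 else
           evn (nth 0 v 0) (Nat.testbit (nth 1 v 0)) g (i :: pred r :: skipn 3 v))
        (nth 2 v 0)).
      { intros X [|x [|y [|z v]]] _ H; try discriminate; reflexivity. }
      eapply comp_rec; cbv beta.
      * comp_auto.
      * apply comp_evn_app with k; [apply IHf|comp_auto|comp_auto|].
        exact (compl_skipn Cl 3 k).
      * apply (comp_if Cl _ (fun X w => nth 1 w 0 =? 0) (fun _ _ => 0));
          [comp_auto|comp_auto|].
        apply comp_evn_app with (S (S k)); [apply IHg|comp_auto|comp_auto|].
        apply compl_cons; [comp_auto|]. apply compl_cons; [comp_auto|].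
        eapply compl_ext; [|exact (compl_skipn Cl 5 k)]. intros X [|x [|y v]]; reflexivity.
  - cbn [evn]. cbv zeta.
    assert (Hb : comp Cl (S (S k)) (fun X v => bmin (nth 0 v 0) (fun i =>
        evn (nth 0 v 0) (Nat.testbit (nth 1 v 0)) f (i :: tl (tl v)) <=? 1))).
    { eapply comp_bmin; cbv beta; [comp_auto|]. apply compb_leb; [|comp_auto].
      apply comp_evn_app with (S k); [apply IHf|comp_auto|comp_auto|].
      apply compl_cons; [comp_auto|].
      eapply compl_ext; [|exact (compl_skipn Cl 3 k)].
      intros X [|x [|y [|z v]]]; reflexivity. }
    assert (Hv : comp Cl (S (S k)) (fun X v =>
      evn (nth 0 v 0) (Nat.testbit (nth 1 v 0)) f
        (bmin (nth 0 v 0) (fun i =>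
          evn (nth 0 v 0) (Nat.testbit (nth 1 v 0)) f (i :: tl (tl v)) <=? 1)
         :: tl (tl v)))).
    { apply comp_evn_app with (S k); [apply IHf|comp_auto|comp_auto|].
      apply compl_cons; [exact Hb|apply Hargs]. }
    apply (comp_if Cl _ (fun X v => bmin (nth 0 v 0) (fun i =>
        evn (nth 0 v 0) (Nat.testbit (nth 1 v 0)) f (i :: tl (tl v)) <=? 1) <? nth 0 v 0)
      _ (fun _ _ => 0)); [apply compb_ltb; [exact Hb|comp_auto]| |comp_auto].
    apply (comp_if Cl _ (fun X v => 
      evn (nth 0 v 0) (Nat.testbit (nth 1 v 0)) f
        (bmin (nth 0 v 0) (fun i =>
          evn (nth 0 v 0) (Nat.testbit (nth 1 v 0)) f (i :: tl (tl v)) <=? 1)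
         :: tl (tl v)) =? 1) _ (fun _ _ => 0));
      [apply compb_eqb; [exact Hv|comp_auto]| |comp_auto].
    apply comp_S. exact Hb.
Qed.

Lemma comp_evn1 Cl n e T G x :
  comp Cl n T -> comp Cl n G -> comp Cl n x ->
  comp Cl n (fun X v => evn (T X v) (Nat.testbit (G X v)) e [x X v]).
Proof.
  intros HT HG Hx. apply comp_evn_app with 1; auto; [apply comp_evn|].
  apply compl_cons; [exact Hx|apply compl_nil].
Qed.
#[export] Hint Resolve comp_evn1 : comp.

(** Under [empty_oracle] every query answers 0, exactly as [Zero] does. Replacing the queries lets a
    computable relation be decided from any oracle. *)
Fixpoint deorac (e : code) : code :=
  match e with
  | Orac => Zero
  | Comp f gs => Comp (deorac f) (map deorac gs)
  | Rec f g => Rec (deorac f) (deorac g)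
  | Mu f => Mu (deorac f)
  | e => e
  end.

Lemma eval_deorac X e args y : eval empty_oracle e args y -> eval X (deorac e) args y
with evalList_deorac X gs args ys :
  evalList empty_oracle gs args ys -> evalList X (map deorac gs) args ys.
Proof.
  - intros H.
    destruct H as [args|x args|i args x Hx|x args|f gs args ys y Hgs Hf|f g args y Hf
      |f g n args r y Hr Hg|f args n H0 Hlt]; cbn [deorac].
    + constructor.
    + constructor.
    + now constructor.
    + constructor.
    + econstructor; [apply evalList_deorac, Hgs|apply eval_deorac, Hf].
    + constructor. apply eval_deorac, Hf.
    + econstructor; [exact (eval_deorac X _ _ _ Hr)|apply eval_deorac, Hg].
    + constructor; [apply eval_deorac, H0|].
      intros m Hm. destruct (Hlt m Hm) as [k Hk]. exists k. apply eval_deorac, Hk.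
  - intros H. destruct H as [args|g gs args y ys Hg Hgs]; cbn [map].
    + constructor.
    + constructor; [apply eval_deorac, Hg|apply evalList_deorac, Hgs].
Qed.

(** * Enumerating the codes *)

Fixpoint code_num (e : code) : nat :=
  match e with
  | Zero => to_nat (0, 0)
  | Succ => to_nat (1, 0)
  | Proj i => to_nat (2, i)
  | Orac => to_nat (3, 0)
  | Comp f gs => to_nat (4, to_nat (code_num f,
      (fix go l := match l with [] => 0 | g :: l => S (to_nat (code_num g, go l)) end) gs))
  | Rec f g => to_nat (5, to_nat (code_num f, code_num g))
  | Mu f => to_nat (6, code_num f)
  end.

Lemma to_nat_pair_inj a b c d : to_nat (a, b) = to_nat (c, d) -> a = c /\ b = d.
Proof. intros H. apply to_nat_inj in H. now injection H. Qed.

Lemma code_num_inj e : forall e', code_num e = code_num e' -> e = e'.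
Proof.
  induction e as [ | | i | | f gs IHf IHgs | f g IHf IHg | f IHf ]
    using code_nested_ind; intros e' H; destruct e'; cbn [code_num] in H;
    apply to_nat_pair_inj in H; destruct H as [H0 H]; try discriminate; clear H0; auto.
  - apply to_nat_pair_inj in H. destruct H as [E1 E2].
    f_equal; [now apply IHf|]. revert l E2.
    induction IHgs as [|g gs Hg _ IHl]; intros [|g' l] E; try discriminate; auto.
    apply eq_add_S, to_nat_pair_inj in E. destruct E as [Ea Eb].
    f_equal; [now apply Hg|now apply IHl].
  - apply to_nat_pair_inj in H. destruct H as [E1 E2].
    f_equal; [now apply IHf|now apply IHg].
  - f_equal. now apply IHf.
Qed.

(** The construction in [good_exists] has to meet every functional at some stage. *)
Lemma code_enum : exists d : nat -> code, forall e, exists n, d n = e.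
Proof.
  exists (fun n => epsilon (inhabits Zero) (fun e => code_num e = n)).
  intros e. exists (code_num e). apply code_num_inj.
  apply (epsilon_spec (inhabits Zero) (fun e' => code_num e' = code_num e)).
  now exists e.
Qed.

(** * Uniformization *)

Definition subb (f g : nat) : bool :=
  ball f (fun x => negb (Nat.testbit f x) || Nat.testbit g x).

Lemma subb_spec f g : subb f g = true <-> bsub f g.
Proof.
  unfold subb. rewrite ball_spec. split.
  - intros H x Hx. specialize (H x (testbit_lt _ _ Hx)). now rewrite Hx in H.
  - intros H x _. destruct (Nat.testbit f x) eqn:E; auto. simpl. auto.
Qed.

(** Every set between [f] and [h] may serve as the oracle, not only [h]: this gives monotonicity in
    [h]. These sets and the stage are numbers at most [h], so the relation is decidable. *)
Definition ob (e : code) (f n h : nat) : bool :=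
  bex (S h) (fun g => subb f g && (subb g h &&
    bex (S h) (fun t => 1 <=? evn t (Nat.testbit g) e [n]))).

Lemma ob_spec e f n h : ob e f n h = true <->
  exists g t, bsub f g /\ bsub g h /\ t <= h /\ evn t (Nat.testbit g) e [n] <> 0.
Proof.
  unfold ob. rewrite bex_spec. split.
  - intros [g [Hg H]]. rewrite !andb_true_iff, !subb_spec, bex_spec in H.
    destruct H as [H1 [H2 [t [Ht H3]]]]. apply Nat.leb_le in H3.
    exists g, t. repeat split; auto; lia.
  - intros [g [t [H1 [H2 [H3 H4]]]]]. exists g.
    split; [apply bsub_le in H2; lia|].
    rewrite !andb_true_iff, !subb_spec, bex_spec. repeat split; auto.
    exists t. rewrite Nat.leb_le. lia.
Qed.

Lemma ob_mono e f n h h' : bsub h h' -> ob e f n h = true -> ob e f n h' = true.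
Proof.
  rewrite !ob_spec. intros Hh [g [t [H1 [H2 [H3 H4]]]]]. exists g, t.
  apply bsub_le in Hh as Hle. repeat split; auto; [|lia].
  intros x Hx. auto.
Qed.

Definition bunion (f h : nat) : nat :=
  mask (fun x => Nat.testbit f x || Nat.testbit h x) (f + h).

Lemma testbit_bunion f h x :
  Nat.testbit (bunion f h) x = Nat.testbit f x || Nat.testbit h x.
Proof.
  unfold bunion. rewrite testbit_mask.
  destruct (Nat.testbit f x || Nat.testbit h x) eqn:E; [|apply andb_false_r].
  rewrite andb_true_r. apply Nat.ltb_lt. apply orb_true_iff in E.
  destruct E as [E|E]; apply testbit_lt in E; lia.
Qed.

Lemma compb_ob Cl n e f x h :
  comp Cl n x -> comp Cl n h -> compb Cl n (fun X v => ob e f (x X v) (h X v)).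
Proof.
  apply (comp_app2 Cl n (fun X a b => Nat.b2n (ob e f a b))).
  change (compb Cl 2 (fun X v => ob e f (nth 0 v 0) (nth 1 v 0))).
  unfold ob, subb. comp_auto.
Qed.

Lemma comp_bunion Cl n f h :
  comp Cl n f -> comp Cl n h -> comp Cl n (fun X v => bunion (f X v) (h X v)).
Proof.
  apply (comp_app2 Cl n (fun X a b => bunion a b)). unfold bunion. comp_auto.
Qed.
#[export] Hint Resolve compb_ob comp_bunion : comp.

Lemma bsub_mask X Y v w :
  (forall x, x < v -> X x = true -> x < w /\ Y x = true) -> bsub (mask X v) (mask Y w).
Proof.
  intros H x. rewrite !testbit_mask, !andb_true_iff, !Nat.ltb_lt.
  intros [H1 H2]. auto.
Qed.

Lemma bsub_to_mask h Y w :
  (forall x, Nat.testbit h x = true -> x < w /\ Y x = true) -> bsub h (mask Y w).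
Proof.
  intros H x Hx. rewrite testbit_mask, andb_true_iff, Nat.ltb_lt. auto.
Qed.

Lemma bit_lt g v x : g < 2 ^ v -> Nat.testbit g x = true -> x < v.
Proof.
  intros Hg Hx. destruct (le_lt_dec v x); auto.
  rewrite (testbit_high g v) in Hx; auto; discriminate.
Qed.

Lemma mask_ge X x v : X x = true -> x < v -> x < mask X v.
Proof. intros Hx Hv. apply testbit_lt. now rewrite testbit_mask, Hx, (proj2 (Nat.ltb_lt x v)). Qed.

Section Uniformization.
Variables A B : nat -> bool.
Hypothesis Binf : set_infinite B.
Hypothesis Hce : forall S, set_infinite S -> subset S B -> ce_in S A.

Record cond : Type := Cond {
  stem : nat;
  bnd : nat;
  cstr : list (nat * code * nat) }.

(* A condition stands for the infinite subsets of [B] that extend the stem and on which,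
   for every constraint [(f, e, n)], no finite subset containing [f] makes [e] converge on [n]. *)
Definition cls (c : cond) (X : nat -> bool) : Prop :=
  set_infinite X /\ subset X B /\
  (forall x, x < bnd c -> X x = Nat.testbit (stem c) x) /\
  (forall f e n, In (f, e, n) (cstr c) -> forall v, ob e f n (mask X v) = false).

Definition valid (c : cond) : Prop := stem c < 2 ^ bnd c /\ exists X, cls c X.

Definition ext (c c' : cond) : Prop :=
  bnd c <= bnd c' /\
  (forall x, x < bnd c -> Nat.testbit (stem c') x = Nat.testbit (stem c) x) /\
  incl (cstr c) (cstr c').

Definition proper (c c' : cond) : Prop :=
  bnd c < bnd c' /\ exists x, bnd c <= x < bnd c' /\ Nat.testbit (stem c') x = true.

Definition good (e : code) (c : cond) : Prop :=
  forall X, cls c X ->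
    (forall n v, ob e (stem c) n (mask X v) = true -> A n = true) /\
    (forall n, A n = true -> exists v, ob e (stem c) n (mask X v) = true).

(** The two ways to prevent [e] from enumerating [A] on the set under construction: a convergence on
    some [n] outside [A], secured by the bits already fixed, or a constraint that forbids
    convergence on some [n] in [A]. *)
Definition diag (e : code) (c : cond) : Prop :=
  (exists n, A n = false /\ evn (bnd c) (Nat.testbit (stem c)) e [n] <> 0) \/
  (exists n f, A n = true /\ In (f, e, n) (cstr c) /\ bsub f (stem c)).

Lemma ext_refl c : ext c c.
Proof. split; [lia|]. split; [auto|apply incl_refl]. Qed.

Lemma ext_trans c1 c2 c3 : ext c1 c2 -> ext c2 c3 -> ext c1 c3.
Proof.
  intros [H1 [H2 H3]] [H4 [H5 H6]]. split; [lia|]. split.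
  - intros x Hx. rewrite H5, H2; auto; lia.
  - eapply incl_tran; eauto.
Qed.

Lemma ext_bsub c c' : stem c < 2 ^ bnd c -> ext c c' -> bsub (stem c) (stem c').
Proof.
  intros Hc [_ [H _]] x Hx. rewrite H; auto. now apply bit_lt with (stem c).
Qed.

Lemma diag_ext e c c' : stem c < 2 ^ bnd c -> ext c c' -> diag e c -> diag e c'.
Proof.
  intros Hc Hext [[n [H1 H2]]|[n [f [H1 [H2 H3]]]]].
  - left. exists n. split; auto. destruct Hext as [E1 [E2 _]].
    destruct (evn (bnd c) (Nat.testbit (stem c)) e [n]) as [|y] eqn:E; [congruence|].
    rewrite (evn_mono (bnd c) (bnd c') (Nat.testbit (stem c)) (Nat.testbit (stem c')) e)
      with (y := y); auto. intros x Hx. symmetry. auto.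
  - right. exists n, f. split; auto. split.
    + destruct Hext as [_ [_ E]]. auto.
    + intros x Hx. apply (ext_bsub c c' Hc Hext). auto.
Qed.

(** [X] cut down to [g] below [v] is a subset of [X], and by monotonicity of [ob] a subset inherits
    all constraints. This set keeps the new condition valid. *)
Lemma freeze c X g v :
  cls c X -> bnd c <= v -> g < 2 ^ v ->
  (forall x, x < bnd c -> Nat.testbit g x = Nat.testbit (stem c) x) ->
  (forall x, Nat.testbit g x = true -> X x = true) ->
  valid (Cond g v (cstr c)) /\ ext c (Cond g v (cstr c)).
Proof.
  intros [H1 [H2 [H3 H4]]] Hv Hg Ha Hs. split; [split; [exact Hg|]|].
  - set (Y := fun x => if x <? v then Nat.testbit g x else X x).
    assert (HY : forall x, Y x = true -> X x = true).
    { intros x. unfold Y. destruct (x <? v); auto. }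
    exists Y. split; [|split; [|split]].
    + intros m. destruct (H1 (m + v)) as [x [Hx1 Hx2]]. exists x. split; [lia|].
      unfold Y. destruct (Nat.ltb_spec x v); [lia|auto].
    + intros x Hx. auto.
    + cbn. intros x Hx. unfold Y. now rewrite (proj2 (Nat.ltb_lt x v)).
    + cbn. intros f e n Hin w.
      apply not_true_is_false. intros E.
      apply ob_mono with (h' := mask X w) in E; [|apply bsub_mask; auto].
      rewrite H4 in E; auto. discriminate.
  - split; [exact Hv|]. split; [exact Ha|apply incl_refl].
Qed.

Lemma grow c : valid c -> exists c', valid c' /\ ext c c' /\ proper c c'.
Proof.
  intros [Hc [X HX]]. destruct (proj1 HX (bnd c)) as [x [Hx1 Hx2]].
  destruct (freeze c X (mask X (S x)) (S x) HX) as [H1 H2].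
  - lia.
  - apply mask_lt.
  - intros y Hy. rewrite testbit_mask, (proj2 (Nat.ltb_lt y (S x))) by lia.
    simpl. apply HX. auto.
  - intros y. rewrite testbit_mask. now destruct (y <? S x).
  - eexists. split; [exact H1|]. split; [exact H2|].
    split; cbn [stem bnd]; [lia|]. exists x. split; [lia|].
    rewrite testbit_mask, (proj2 (Nat.ltb_lt x (S x))) by lia. auto.
Qed.

(** Either half of [good] that fails supplies its own diagonalization: the oracle of a wrong witness
    becomes the new stem, while a member of the class without a witness shows that the new
    constraint leaves the class nonempty. *)
Lemma step e c : valid c -> ~ good e c ->
  exists c', valid c' /\ ext c c' /\ proper c c' /\ diag e c'.
Proof.
  intros Hv Hng.
  assert (Hs : exists c', valid c' /\ ext c c' /\ diag e c').
  { destruct Hv as [Hc _]. apply not_all_ex_not in Hng. destruct Hng as [X HX].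
    apply imply_to_and in HX. destruct HX as [HX Hn]. apply not_and_or in Hn.
    destruct Hn as [Hn|Hn]; apply not_all_ex_not in Hn; destruct Hn as [n Hn].
    - apply not_all_ex_not in Hn. destruct Hn as [v Hn].
      apply imply_to_and in Hn. destruct Hn as [H1 H2].
      apply ob_spec in H1. destruct H1 as [g [t [G1 [G2 [G3 G4]]]]].
      assert (GX : forall x, Nat.testbit g x = true -> X x = true).
      { intros x Hx. apply G2 in Hx. rewrite testbit_mask in Hx.
        now destruct (x <? v). }
      (* The new bound is at least [t], so the stem fixes every bit that the computation queries. *)
      destruct (freeze c X g (bnd c + v + t) HX) as [V1 V2].
      + lia.
      + apply bsub_le in G2. generalize (mask_lt X v). intros E.
        apply Nat.le_lt_trans with (mask X v); auto.
        apply Nat.lt_le_trans with (2 ^ v); auto. apply Nat.pow_le_mono_r; lia.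
      + intros x Hx. destruct HX as [_ [_ [HX _]]].
        destruct (Nat.testbit g x) eqn:E.
        * apply GX in E. rewrite <- HX; auto.
        * destruct (Nat.testbit (stem c) x) eqn:E'; auto. apply G1 in E'. congruence.
      + exact GX.
      + eexists. split; [exact V1|]. split; [exact V2|]. left. exists n. cbn.
        split; [now destruct (A n)|].
        destruct (evn t (Nat.testbit g) e [n]) as [|y] eqn:E; [congruence|].
        rewrite (evn_mono t (bnd c + v + t) (Nat.testbit g) (Nat.testbit g) e)
          with (y := y); auto. lia.
    - apply imply_to_and in Hn. destruct Hn as [H1 H2].
      exists (Cond (stem c) (bnd c) ((stem c, e, n) :: cstr c)). split; [|split].
      + split; [exact Hc|]. exists X. destruct HX as [X1 [X2 [X3 X4]]].
        split; [auto|]. split; [auto|]. split; [exact X3|]. cbn.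
        intros f e' n' [E|E] v; [|now apply X4]. injection E as <- <- <-.
        apply not_true_is_false. intros Hob. apply H2. now exists v.
      + split; cbn; [lia|]. split; [auto|]. apply incl_tl, incl_refl.
      + right. exists n, (stem c). cbn. split; auto. split; auto. intros x Hx. exact Hx. }
  destruct Hs as [c1 [V1 [E1 D1]]].
  destruct (grow c1 V1) as [c2 [V2 [E2 [P1 [x [P2 P3]]]]]].
  exists c2. split; [auto|]. split; [now apply ext_trans with c1|]. split.
  - destruct E1 as [E1 _]. split; [lia|]. exists x. split; [lia|auto].
  - apply diag_ext with c1; auto. apply V1.
Qed.

Lemma ob_intro e f n t X :
  set_infinite X -> (forall x, Nat.testbit f x = true -> X x = true) ->
  evn t X e [n] <> 0 -> exists v, ob e f n (mask X v) = true.
Proof.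
  intros HX Hf He. destruct (HX (t + f)) as [x [Hx1 Hx2]]. exists (S x).
  apply ob_spec. exists (mask X (S x)), t.
  assert (Hm : x < mask X (S x)) by (apply mask_ge; auto).
  split; [|split; [|split]].
  - apply bsub_to_mask. intros y Hy. apply testbit_lt in Hy as Hy'. split; [lia|auto].
  - intros y Hy. exact Hy.
  - lia.
  - destruct (evn t X e [n]) as [|y] eqn:E; [congruence|].
    rewrite (evn_mono t t X (Nat.testbit (mask X (S x))) e) with (y := y); auto.
    intros z Hz. rewrite testbit_mask, (proj2 (Nat.ltb_lt z (S x))) by lia. reflexivity.
Qed.

Lemma good_exists : exists e c, valid c /\ good e c.
Proof.
  apply NNPP. intros Hno.
  assert (Hng : forall e c, valid c -> ~ good e c).
  { intros e c Hv Hg. apply Hno. now exists e, c. }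
  set (c0 := Cond 0 0 []).
  assert (V0 : valid c0).
  { split; [cbn; lia|]. exists B. split; [auto|]. split; [intros x Hx; exact Hx|].
    split; cbn; [lia|tauto]. }
  destruct code_enum as [d Hd].
  set (next := fun e c => epsilon (inhabits c0)
    (fun c' => valid c' /\ ext c c' /\ proper c c' /\ diag e c')).
  assert (Hnext : forall e c, valid c -> valid (next e c) /\ ext c (next e c) /\
     proper c (next e c) /\ diag e (next e c)).
  { intros e c Hv.
    apply (epsilon_spec (inhabits c0)
      (fun c' => valid c' /\ ext c c' /\ proper c c' /\ diag e c')).
    apply step; auto. }
  set (s := nat_rect (fun _ => cond) c0 (fun i c => next (d i) c)).
  assert (Vs : forall i, valid (s i)).
  { induction i as [|i IH]; [exact V0|]. apply (Hnext (d i) (s i) IH). }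
  assert (Es : forall i, ext (s i) (s (S i)) /\ proper (s i) (s (S i)) /\ diag (d i) (s (S i))).
  { intros i. apply (Hnext (d i) (s i) (Vs i)). }
  assert (Em : forall i j, i <= j -> ext (s i) (s j)).
  { intros i j H. induction H as [|j H IH]; [apply ext_refl|].
    apply ext_trans with (s j); [auto|apply Es]. }
  assert (Hb : forall i, i <= bnd (s i)).
  { induction i as [|i IH]; [lia|]. destruct (Es i) as [_ [[H _] _]]. lia. }
  (* Bit [x] is final at stage [S x], since [i <= bnd (s i)]. *)
  set (X := fun x => Nat.testbit (stem (s (S x))) x).
  assert (HX : forall i x, x < bnd (s i) -> X x = Nat.testbit (stem (s i)) x).
  { intros i x Hx. unfold X. destruct (le_lt_dec i (S x)) as [H|H].
    - destruct (Em _ _ H) as [_ [E _]]. auto.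
    - destruct (Em (S x) i) as [_ [E _]]; [lia|]. symmetry. apply E.
      specialize (Hb (S x)). lia. }
  assert (Xinf : set_infinite X).
  { intros m. destruct (Es m) as [_ [[_ [x [Hx1 Hx2]]] _]]. exists x.
    split; [specialize (Hb m); lia|]. rewrite (HX (S m)); auto; lia. }
  assert (XB : subset X B).
  { intros x Hx. destruct (Vs (S x)) as [_ [Y [_ [Y2 [Y3 _]]]]].
    apply Y2. rewrite Y3; [exact Hx|]. specialize (Hb (S x)). lia. }
  destruct (Hce X Xinf XB) as [e He]. destruct (Hd e) as [i Hi].
  destruct (Es i) as [_ [_ Hdi]]. rewrite Hi in Hdi.
  destruct Hdi as [[n [H1 H2]]|[n [f [H1 [H2 H3]]]]].
  - destruct (evn (bnd (s (S i))) (Nat.testbit (stem (s (S i)))) e [n]) as [|y] eqn:E;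
      [congruence|].
    assert (H : A n = true); [|congruence]. apply He. exists y.
    apply evn_sound with (bnd (s (S i))) (Nat.testbit (stem (s (S i)))); auto.
  - apply He in H1. destruct H1 as [y Hy]. apply eval_complete in Hy.
    destruct Hy as [t Ht].
    destruct (ob_intro e f n t X Xinf) as [v Hv]; [|congruence|].
    + intros x Hx. rewrite (HX (S i)); [auto|].
      apply bit_lt with (stem (s (S i))); [apply Vs|auto].
    (* [Y] belongs to the class at stage [j]: it still obeys the constraint, and it agrees with [X]
       below [v], where the witness lies. *)
    + set (j := S i + v). destruct (Vs j) as [_ [Y [_ [_ [Y3 Y4]]]]].
      assert (Hin : In (f, e, n) (cstr (s j))).
      { destruct (Em (S i) j) as [_ [_ E]]; [lia|]. auto. }
      specialize (Y4 _ _ _ Hin v).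
      rewrite (mask_ext Y X v) in Y4; [congruence|].
      intros x Hx. specialize (Hb j). rewrite (HX j), Y3; auto; lia.
Qed.

(* [K] tells finite sets that may still extend to a set on which [O] enumerates [A]. *)
Lemma uniform_enumeration : exists (O : nat -> nat -> bool) (K : nat -> bool) (C : nat -> bool),
  (forall Cl n x h, comp Cl n x -> comp Cl n h ->
     compb Cl n (fun X v => O (x X v) (h X v))) /\
  (forall Cl n h, comp Cl n h -> compb Cl n (fun X v => K (h X v))) /\
  (forall n h h', bsub h h' -> O n h = true -> O n h' = true) /\
  (forall h h', bsub h h' -> K h' = true -> K h = true) /\
  set_infinite C /\ subset C B /\ (forall v, K (mask C v) = true) /\
  (forall n h, (forall x, Nat.testbit h x = true -> C x = true) ->
     O n h = true -> A n = true) /\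
  (forall X, set_infinite X -> subset X B -> (forall v, K (mask X v) = true) ->
     forall n, A n = true -> exists v, O n (mask X v) = true).
Proof.
  destruct good_exists as [e [[f u L] [[Hf [S HS]] Hg]]]. cbn in Hf.
  (* The stem is put back by [bunion], so the subsets of [C], which lies above the stem, need not
     contain it. *)
  set (O := fun n h => ob e f n (bunion f h)).
  set (K := fun h => ball u (fun x => negb (Nat.testbit h x)) &&
    forallb (fun p => negb (ob (snd (fst p)) (fst (fst p)) (snd p) (bunion f h))) L).
  set (C := fun x => (u <=? x) && S x).
  assert (Hbu : forall h h', bsub h h' -> bsub (bunion f h) (bunion f h')).
  { intros h h' H x. rewrite !testbit_bunion, !orb_true_iff.
    intros [Hx|Hx]; auto. }
  assert (HK : forall h, K h = true <-> (forall x, Nat.testbit h x = true -> u <= x) /\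
     forall f' e' n', In (f', e', n') L -> ob e' f' n' (bunion f h) = false).
  { intros h. unfold K. rewrite andb_true_iff, ball_spec, forallb_forall. split.
    - intros [H1 H2]. split.
      + intros x Hx. destruct (le_lt_dec u x); auto.
        specialize (H1 x l). rewrite Hx in H1. discriminate.
      + intros f' e' n' Hin. specialize (H2 _ Hin). cbn [fst snd] in H2.
        now apply negb_true_iff.
    - intros [H1 H2]. split.
      + intros x Hx. apply negb_true_iff, not_true_is_false. intros E.
        apply H1 in E. lia.
      + intros [[f' e'] n'] Hin. cbn [fst snd]. now rewrite H2. }
  assert (HSC : forall h, (forall x, Nat.testbit h x = true -> C x = true) ->
     bsub (bunion f h) (mask S (bunion f h))).
  { intros h Hh. apply bsub_to_mask. intros x Hx. split; [now apply testbit_lt|].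
    rewrite testbit_bunion, orb_true_iff in Hx. destruct Hx as [Hx|Hx].
    - destruct HS as [_ [_ [H _]]]. cbn in H. rewrite H; auto. now apply bit_lt with f.
    - apply Hh in Hx. unfold C in Hx. now destruct (u <=? x). }
  exists O, K, C. split; [|split; [|split; [|split; [|split; [|split; [|split; [|split]]]]]]].
  - intros Cl n x h Hx Hh. unfold O. comp_auto.
  - intros Cl n h Hh. apply (comp_app1 Cl n (fun _ h => Nat.b2n (K h))); [|exact Hh].
    change (compb Cl 1 (fun X v => K (nth 0 v 0))). unfold K.
    apply compb_and; [comp_auto|]. clear. induction L as [|p L IH]; cbn [forallb]; comp_auto.
  - intros n h h' H. apply ob_mono. auto.
  - intros h h' H. rewrite !HK. intros [H1 H2]. split; [auto|].
    intros f' e' n' Hin. apply not_true_is_false. intros E.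
    apply ob_mono with (h' := bunion f h') in E; [|auto].
    rewrite H2 in E; auto. discriminate.
  - intros m. destruct (proj1 HS (m + u)) as [x [Hx1 Hx2]]. exists x.
    split; [lia|]. unfold C. rewrite (proj2 (Nat.leb_le u x)); auto; lia.
  - intros x Hx. apply HS. unfold C in Hx. now destruct (u <=? x).
  - intros v. apply HK.
    assert (Hh : forall x, Nat.testbit (mask C v) x = true -> C x = true).
    { intros x. rewrite testbit_mask. now destruct (x <? v). }
    split.
    + intros x Hx. apply Hh in Hx. unfold C in Hx.
      destruct (Nat.leb_spec u x); auto. discriminate.
    + intros f' e' n' Hin. apply not_true_is_false. intros E.
      apply (ob_mono _ _ _ _ _ (HSC _ Hh)) in E.
      destruct HS as [_ [_ [_ H]]]. rewrite H in E; auto. discriminate.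
  - intros n h Hh E. apply (ob_mono _ _ _ _ _ (HSC _ Hh)) in E.
    destruct (Hg S HS) as [H _]. apply H in E. exact E.
  - intros X HX XB HKX n Hn.
    assert (Xu : forall x, X x = true -> u <= x).
    { intros x Hx. apply (proj1 (proj1 (HK _) (HKX (Datatypes.S x)))).
      rewrite testbit_mask, Hx, (proj2 (Nat.ltb_lt x (Datatypes.S x))); auto. }
    (* Restoring the stem puts [X] into the class: [K] on its initial segments is what the
       constraints demand. *)
    set (Y := fun x => if x <? u then Nat.testbit f x else X x).
    assert (HY : forall v, bsub (mask Y v) (bunion f (mask X v))).
    { intros v x. rewrite testbit_mask, testbit_bunion, testbit_mask. unfold Y.
      destruct (x <? v); [|discriminate]. destruct (x <? u); simpl; intros ->; auto.
      apply orb_true_r. }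
    destruct (Hg Y) as [_ H].
    + split; [|split; [|split]].
      * intros m. destruct (HX (m + u)) as [x [Hx1 Hx2]]. exists x. split; [lia|].
        unfold Y. destruct (Nat.ltb_spec x u); [lia|auto].
      * intros x. unfold Y. destruct (Nat.ltb_spec x u) as [Hx|Hx]; [|auto].
        intros E. apply HS. destruct HS as [_ [_ [HS _]]]. rewrite HS; auto.
      * cbn. intros x Hx. unfold Y. now rewrite (proj2 (Nat.ltb_lt x u)).
      * cbn. intros f' e' n' Hin v. apply not_true_is_false. intros E.
        apply (ob_mono _ _ _ _ _ (HY v)) in E.
        destruct (proj1 (HK _) (HKX v)) as [_ H]. rewrite H in E; auto. discriminate.
    + destruct (H n Hn) as [v Hv]. exists v. unfold O.
      exact (ob_mono _ _ _ _ _ (HY v) Hv).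
Qed.

End Uniformization.

(** * Fusion and the Galvin-Prikry theorem for open sets *)

Definition asb (P : Prop) : bool := if excluded_middle_informative P then true else false.

Lemma asb_spec P : asb P = true <-> P.
Proof. unfold asb. destruct (excluded_middle_informative P); split; auto; discriminate. Qed.

Lemma asb_true P : asb P = true -> P.
Proof. apply asb_spec. Qed.

Lemma true_asb (P : Prop) : P -> asb P = true.
Proof. intros H. now apply asb_spec. Qed.

Definition tail (X : nat -> bool) (k : nat) : nat -> bool := fun x => (k <? x) && X x.

Lemma tail_spec X k x : tail X k x = true <-> k < x /\ X x = true.
Proof. unfold tail. now rewrite andb_true_iff, Nat.ltb_lt. Qed.

Lemma tail_infinite X k : set_infinite X -> set_infinite (tail X k).
Proof.
  intros H m. destruct (H (S (m + k))) as [x [H1 H2]]. exists x.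
  split; [lia|]. apply tail_spec. split; [lia|auto].
Qed.

Lemma tail_mono X Y k : subset X Y -> subset (tail X k) (tail Y k).
Proof. intros H x. rewrite !tail_spec. intros [H1 H2]. auto. Qed.

Lemma tail_subset X k : subset (tail X k) X.
Proof. intros x H. now apply tail_spec in H. Qed.

Lemma subset_refl X : subset X X.
Proof. intros x H. exact H. Qed.

Lemma subset_trans X Y Z : subset X Y -> subset Y Z -> subset X Z.
Proof. intros H1 H2 x H. auto. Qed.

Definition dense (X0 : nat -> bool) (P : (nat -> bool) -> Prop) : Prop :=
  forall X, set_infinite X -> subset X X0 ->
    exists Y, set_infinite Y /\ subset Y X /\ P Y.

Definition hereditary (P : (nat -> bool) -> Prop) : Prop :=
  forall X Y, set_infinite Y -> subset Y X -> P X -> P Y.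

Lemma dense_finite X0 (Q : nat -> (nat -> bool) -> Prop) N :
  (forall s, s < N -> dense X0 (Q s)) -> (forall s, hereditary (Q s)) ->
  dense X0 (fun Y => forall s, s < N -> Q s Y).
Proof.
  intros HQ Hh. induction N as [|N IH]; intros X HX HX0.
  - exists X. split; [auto|]. split; [apply subset_refl|]. lia.
  - destruct (IH ltac:(intros; apply HQ; lia) X HX HX0) as [Y [Y1 [Y2 Y3]]].
    destruct (HQ N ltac:(lia) Y Y1 (subset_trans _ _ _ Y2 HX0)) as [Z [Z1 [Z2 Z3]]].
    exists Z. split; [auto|]. split; [now apply subset_trans with Y|].
    intros s Hs. destruct (Nat.eq_dec s N) as [->|Hne]; auto.
    apply Hh with Y; auto. apply Y3. lia.
Qed.

(** Take the least element [k] of the current set, shrink what lies above it until [P k] holds, and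
    repeat; all elements taken after [k] lie in the set chosen for [k]. Besides homogeneity this
    yields sparseness, when [P k] says that all members exceed a bound depending on [k]. *)
Lemma fusion (P : nat -> (nat -> bool) -> Prop) X0 :
  set_infinite X0 -> (forall k, dense X0 (P k)) -> (forall k, hereditary (P k)) ->
  exists Y, set_infinite Y /\ subset Y X0 /\ forall k, Y k = true -> P k (tail Y k).
Proof.
  intros HX0 Hd Hh.
  set (next := fun X => epsilon (inhabits X0) (fun Y =>
    set_infinite Y /\ subset Y (tail X (mu X)) /\ P (mu X) Y)).
  set (s := nat_rect (fun _ => nat -> bool) X0 (fun _ X => next X)).
  assert (Hn : forall X, set_infinite X -> subset X X0 ->
    set_infinite (next X) /\ subset (next X) (tail X (mu X)) /\ P (mu X) (next X)).
  { intros X H1 H2. apply (epsilon_spec (inhabits X0) (fun Y =>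
      set_infinite Y /\ subset Y (tail X (mu X)) /\ P (mu X) Y)).
    apply Hd; [now apply tail_infinite|].
    apply subset_trans with X; [apply tail_subset|auto]. }
  assert (Hs : forall i, set_infinite (s i) /\ subset (s i) X0).
  { induction i as [|i [I1 I2]]; [split; [exact HX0|apply subset_refl]|].
    destruct (Hn (s i) I1 I2) as [N1 [N2 _]]. split; [exact N1|].
    apply subset_trans with (s i); auto.
    apply subset_trans with (tail (s i) (mu (s i))); [exact N2|apply tail_subset]. }
  assert (Hsn : forall i, subset (s (S i)) (tail (s i) (mu (s i))) /\ P (mu (s i)) (s (S i))).
  { intros i. destruct (Hs i) as [I1 I2]. apply (Hn (s i) I1 I2). }
  assert (Hm : forall i, s i (mu (s i)) = true).
  { intros i. apply mu_spec. destruct (proj1 (Hs i) 0) as [x [_ Hx]]. now exists x. }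
  assert (Hsub : forall i j, i <= j -> subset (s j) (s i)).
  { intros i j H. induction H as [|j H IH]; [apply subset_refl|].
    apply subset_trans with (s j); auto.
    apply subset_trans with (tail (s j) (mu (s j))); [apply Hsn|apply tail_subset]. }
  assert (Hlt : forall i j, i < j -> mu (s i) < mu (s j)).
  { intros i j H. assert (E := Hsub (S i) j H _ (Hm j)).
    apply (proj1 (Hsn i)) in E. now apply tail_spec in E. }
  assert (Hge : forall i, i <= mu (s i)).
  { induction i as [|i IH]; [lia|]. specialize (Hlt i (S i)). lia. }
  exists (fun x => asb (exists i, x = mu (s i))). split; [|split].
  - intros m. exists (mu (s m)). split; [auto|]. apply true_asb. now exists m.
  - intros x Hx. apply asb_true in Hx. destruct Hx as [i ->]. apply (Hs i), Hm.
  - intros k Hk. apply asb_true in Hk. destruct Hk as [i ->].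
    apply Hh with (s (S i)).
    + apply tail_infinite. intros m. exists (mu (s m)).
      split; [auto|]. apply true_asb. now exists m.
    + intros x Hx. apply tail_spec in Hx. destruct Hx as [H1 H2].
      apply asb_true in H2. destruct H2 as [j ->].
      assert (Hij : i < j).
      { destruct (lt_eq_lt_dec i j) as [[H|H]|H]; auto; [subst; lia|].
        specialize (Hlt _ _ H). lia. }
      apply (Hsub (S i) j Hij), Hm.
    + apply Hsn.
Qed.

Section OpenRamsey.
Variable U : (nat -> bool) -> Prop.
Hypothesis Uopen : forall Z, set_infinite Z -> U Z ->
  exists v, forall Y, set_infinite Y -> (forall x, x < v -> Y x = Z x) -> U Y.

Definition mix (k s : nat) (Z : nat -> bool) : nat -> bool :=
  fun x => if x <? k then Nat.testbit s x else Z x.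

Definition accepts (k s : nat) (Y : nat -> bool) : Prop :=
  forall Z, set_infinite Z -> subset Z Y -> U (mix k s Z).

(** Acceptance and rejection are those of Galvin and Prikry. Rejection is stronger than the negation
    of acceptance: no shrinking of [Y] ever leads to acceptance. *)
Definition rejects (k s : nat) (Y : nat -> bool) : Prop :=
  forall Z, set_infinite Z -> subset Z Y -> ~ accepts k s Z.

(** Pointwise equality does not give equality of functions here; openness carries membership
    over. *)
Lemma U_ext Y Z : set_infinite Z -> (forall x, Y x = Z x) -> U Z -> U Y.
Proof.
  intros HZ H HU. destruct (Uopen Z HZ HU) as [v Hv]. apply Hv; auto.
  intros m. destruct (HZ m) as [x [H1 H2]]. exists x. now rewrite H.
Qed.

Lemma mix_infinite k s Z : set_infinite Z -> set_infinite (mix k s Z).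
Proof.
  intros H m. destruct (H (m + k)) as [x [H1 H2]]. exists x. split; [lia|].
  unfold mix. destruct (Nat.ltb_spec x k); [lia|auto].
Qed.

Lemma accepts_hereditary k s : hereditary (accepts k s).
Proof. intros X Y _ H HX Z HZ HZY. apply HX; auto. now apply subset_trans with Y. Qed.

Lemma rejects_hereditary k s : hereditary (rejects k s).
Proof. intros X Y _ H HX Z HZ HZY. apply HX; auto. now apply subset_trans with Y. Qed.

Lemma accepts_tail k s Y : accepts (S k) s (tail Y k) -> accepts (S k) s Y.
Proof.
  intros H Z HZ HZY. apply U_ext with (mix (S k) s (tail Z k)).
  - now apply mix_infinite, tail_infinite.
  - intros x. unfold mix, tail. destruct (Nat.ltb_spec x (S k)); auto.
    destruct (Nat.ltb_spec k x); [auto|lia].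
  - apply H; [now apply tail_infinite|now apply tail_mono].
Qed.

Lemma rejects_tail k s Y : rejects (S k) s (tail Y k) -> rejects (S k) s Y.
Proof.
  intros H Z HZ HZY Hacc. apply (H (tail Z k)).
  - now apply tail_infinite.
  - now apply tail_mono.
  - apply accepts_hereditary with Z; auto; [now apply tail_infinite|apply tail_subset].
Qed.

(** The stems with elements up to [k] are the finitely many numbers below [2 ^ S k], so one fusion
    step can decide them all. The verdict of the tail above [k] is that of the whole set, since
    [mix (S k)] ignores what lies below. *)
Lemma decide_stems X : set_infinite X -> exists Y, set_infinite Y /\ subset Y X /\
  forall k s, Y k = true -> s < 2 ^ S k -> accepts (S k) s Y \/ rejects (S k) s Y.
Proof.
  intros HX.
  destruct (fusion (fun k Y => forall s, s < 2 ^ S k ->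
    accepts (S k) s Y \/ rejects (S k) s Y) X HX) as [Y [Y1 [Y2 Y3]]].
  - intros k. apply dense_finite with (Q := fun s Y =>
      accepts (S k) s Y \/ rejects (S k) s Y).
    + intros s _ Z HZ _. destruct (classic (rejects (S k) s Z)) as [H|H].
      * exists Z. split; [auto|]. split; [apply subset_refl|auto].
      * apply not_all_ex_not in H. destruct H as [W H].
        apply imply_to_and in H. destruct H as [W1 H].
        apply imply_to_and in H. destruct H as [W2 H]. apply NNPP in H.
        exists W. auto.
    + intros s Z W HW HWZ [H|H]; [left|right].
      * now apply accepts_hereditary with Z.
      * now apply rejects_hereditary with Z.
  - intros k Z W HW HWZ H s Hs. destruct (H s Hs) as [Ha|Ha]; [left|right].
    * now apply accepts_hereditary with Z.
    * now apply rejects_hereditary with Z.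
  - exists Y. split; [auto|]. split; [auto|]. intros k s Hk Hs.
    destruct (Y3 k Hk s Hs) as [H|H]; [left; now apply accepts_tail|
      right; now apply rejects_tail].
Qed.

(** If infinitely many one-point extensions were accepted, the set of these points would accept [s]
    itself: any infinite subset [Z] extends the stem by its own least point first. *)
Lemma rejects_step Y k s :
  set_infinite Y ->
  (forall k s, Y k = true -> s < 2 ^ S k -> accepts (S k) s Y \/ rejects (S k) s Y) ->
  s < 2 ^ k -> rejects k s Y ->
  exists b, forall t, Y t = true -> b <= t -> rejects (S t) (s + 2 ^ t) Y.
Proof.
  intros HY Hdec Hs Hrej. apply NNPP. intros Hno.
  set (W := fun t => Y t && ((k <=? t) && asb (accepts (S t) (s + 2 ^ t) Y))).
  assert (HWs : forall t, W t = true ->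
     Y t = true /\ k <= t /\ accepts (S t) (s + 2 ^ t) Y).
  { intros t. unfold W. rewrite !andb_true_iff, Nat.leb_le, asb_spec. auto. }
  assert (HW : set_infinite W).
  { intros m. apply NNPP. intros Hm. apply Hno. exists (m + k). intros t Ht Hbt.
    destruct (Hdec t (s + 2 ^ t)) as [H|H]; auto.
    - assert (2 ^ k <= 2 ^ t) by (apply Nat.pow_le_mono_r; lia).
      rewrite Nat.pow_succ_r'. lia.
    - exfalso. apply Hm. exists t. split; [lia|]. unfold W.
      rewrite !andb_true_iff, Nat.leb_le, asb_spec. repeat split; auto. lia. }
  apply (Hrej W HW).
  - intros t Ht. now apply HWs in Ht.
  - intros Z HZ HZW.
    destruct (mu_spec Z) as [M1 M2].
    { destruct (HZ 0) as [x [_ Hx]]. now exists x. }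
    set (t := mu Z) in *. destruct (HWs t (HZW t M1)) as [T1 [T2 T3]].
    apply U_ext with (mix (S t) (s + 2 ^ t) Z).
    + now apply mix_infinite.
    + intros x. unfold mix.
      assert (H2 : 2 ^ k <= 2 ^ t) by (apply Nat.pow_le_mono_r; lia).
      rewrite testbit_pow2_add by lia.
      destruct (Nat.ltb_spec x k) as [Hx|Hx].
      * rewrite (proj2 (Nat.ltb_lt x (S t))) by lia.
        destruct (Nat.eqb_spec x t); [lia|auto].
      * destruct (Nat.ltb_spec x (S t)) as [Hx'|Hx']; auto.
        destruct (Nat.eqb_spec x t) as [->|Hne]; auto.
        rewrite M2 by lia. symmetry. now apply testbit_high with k.
    + apply T3; auto. intros x Hx. now apply HZW, HWs in Hx.
Qed.

Theorem open_ramsey X : set_infinite X -> exists Y, set_infinite Y /\ subset Y X /\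
  ((forall Z, set_infinite Z -> subset Z Y -> U Z) \/
   (forall Z, set_infinite Z -> subset Z Y -> ~ U Z)).
Proof.
  intros HX. destruct (classic (rejects 0 0 X)) as [Hrej|Hacc].
  2:{ apply not_all_ex_not in Hacc. destruct Hacc as [Y H].
      apply imply_to_and in H. destruct H as [Y1 H].
      apply imply_to_and in H. destruct H as [Y2 H]. apply NNPP in H.
      exists Y. split; [auto|]. split; [auto|]. left. intros Z HZ HZY.
      apply U_ext with (mix 0 0 Z); [now apply mix_infinite|reflexivity|auto]. }
  destruct (decide_stems X HX) as [Y [Y1 [Y2 Y3]]].
  apply (rejects_hereditary 0 0 X Y Y1 Y2) in Hrej.
  destruct (rejects_step Y 0 0 Y1 Y3) as [b Hb]; [simpl; lia|auto|].
  destruct (fusion (fun k W => forall s, s < 2 ^ S k -> rejects (S k) s Y ->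
    forall t, W t = true -> rejects (S t) (s + 2 ^ t) Y) (tail Y b)) as [W [W1 [W2 W3]]].
  - now apply tail_infinite.
  - intros k. apply (dense_finite _ (fun s W => rejects (S k) s Y ->
      forall t, W t = true -> rejects (S t) (s + 2 ^ t) Y)).
    + intros s Hs Z HZ HZY. destruct (classic (rejects (S k) s Y)) as [H|H].
      * destruct (rejects_step Y (S k) s Y1 Y3 Hs H) as [c Hc].
        exists (tail Z c). split; [now apply tail_infinite|].
        split; [apply tail_subset|]. intros _ t Ht. apply tail_spec in Ht.
        destruct Ht as [T1 T2]. apply Hc; [|lia].
        apply HZY, tail_subset in T2. exact T2.
      * exists Z. split; [auto|]. split; [apply subset_refl|]. tauto.
    + intros s V V' _ HV H Hr t Ht. apply H; auto.
  - intros k V V' _ HV H s Hs Hr t Ht. apply H; auto.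
  (* Induction on the largest element [k]. Without it the stem [s'] is either empty, which [b]
     handles, or rejected with its own largest element [k'], and then [W3] adds [k]. *)
  - assert (Hr : forall k s, W k = true -> s < 2 ^ S k -> Nat.testbit s k = true ->
      (forall x, Nat.testbit s x = true -> W x = true) -> rejects (S k) s Y).
    { induction k as [k IH] using lt_wf_ind. intros s Hk Hs Hsk HsW.
      set (s' := mask (Nat.testbit s) k).
      assert (Hs' : s = s' + 2 ^ k).
      { apply bits_ext. intros x.
        rewrite testbit_pow2_add by apply mask_lt. unfold s'. rewrite testbit_mask.
        destruct (Nat.eqb_spec x k) as [->|Hx]; auto.
        destruct (Nat.ltb_spec x k); auto. apply testbit_high with (S k); auto. lia. }
      destruct (Nat.eq_dec s' 0) as [E|E].
      - rewrite Hs', E. apply W2, tail_spec in Hk. destruct Hk as [K1 K2].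
        apply Hb; auto. lia.
      - set (k' := Nat.log2 s').
        assert (B1 : Nat.testbit s' k' = true) by now apply Nat.bit_log2.
        assert (B2 : forall x, Nat.testbit s' x = true -> x < k /\ Nat.testbit s x = true).
        { intros x. unfold s'. rewrite testbit_mask, andb_true_iff, Nat.ltb_lt. auto. }
        assert (B3 : s' < 2 ^ S k') by (apply Nat.log2_spec; lia).
        destruct (B2 k' B1) as [B4 B5].
        rewrite Hs'. apply (W3 k'); auto.
        + apply IH; auto. intros x Hx. apply HsW. now apply B2.
        + apply tail_spec. auto. }
    exists W. split; [auto|]. split.
    + apply subset_trans with Y; auto. apply subset_trans with (tail Y b); auto.
      apply tail_subset.
    (* Openness decides membership of [Z] by a finite stem, and [Y] would accept that stem. *)
    + right. intros Z HZ HZW HU. destruct (Uopen Z HZ HU) as [v Hv].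
      destruct (HZ v) as [k [K1 K2]].
      assert (R : rejects (S k) (mask Z (S k)) Y).
      { apply Hr; [auto|apply mask_lt| |].
        - rewrite testbit_mask, K2, (proj2 (Nat.ltb_lt k (S k))); auto.
        - intros x. rewrite testbit_mask. intros Hx. apply HZW.
          now destruct (x <? S k). }
      apply (R Y Y1 (subset_refl Y)). intros V HV HVY. apply Hv.
      * now apply mix_infinite.
      * intros x Hx. unfold mix. rewrite (proj2 (Nat.ltb_lt x (S k))) by lia.
        now rewrite testbit_mask, (proj2 (Nat.ltb_lt x (S k))) by lia.
Qed.

End OpenRamsey.

(** * Sampling an infinite set *)

Definition nx (X : nat -> bool) (k : nat) : nat := mu (fun x => (k <=? x) && X x).

Lemma nx_spec X k : set_infinite X ->
  k <= nx X k /\ X (nx X k) = true /\ forall x, k <= x -> X x = true -> nx X k <= x.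
Proof.
  intros H. destruct (mu_spec (fun x => (k <=? x) && X x)) as [H1 _].
  - destruct (H k) as [x [Hx1 Hx2]]. exists x. now rewrite (proj2 (Nat.leb_le k x)), Hx2.
  - apply andb_true_iff in H1. destruct H1 as [H1 H2]. apply Nat.leb_le in H1.
    split; [exact H1|]. split; [exact H2|]. intros x Hx Hx2. apply mu_le.
    now rewrite (proj2 (Nat.leb_le k x)), Hx2.
Qed.

(** Round [i] begins at [pos X i] and consumes two consecutive elements of [X], those of index [2 i]
    and [2 i + 1]. *)
Definition pos (X : nat -> bool) (i : nat) : nat :=
  nat_rect (fun _ => nat) 0 (fun _ r => S (nx X (S (nx X r)))) i.
Definition evens (X : nat -> bool) (i : nat) : nat := nx X (pos X i).
Definition odds (X : nat -> bool) (i : nat) : nat := nx X (S (nx X (pos X i))).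
(** For increasing [g] the powers are distinct, so the sum is a bit mask. *)
Definition first (g : nat -> nat) (i : nat) : nat :=
  nat_rect (fun _ => nat) 0 (fun j r => r + 2 ^ g j) i.

Definition increasing (g : nat -> nat) : Prop := forall i, g i < g (S i).

Lemma increasing_lt g i j : increasing g -> i < j -> g i < g j.
Proof.
  intros H Hij. induction Hij as [|j _ IH]; [apply H|].
  specialize (H j). lia.
Qed.

Lemma increasing_ge g i : increasing g -> i <= g i.
Proof. intros H. induction i as [|i IH]; [lia|]. specialize (H i). lia. Qed.

Lemma first_lt g i : increasing g -> first g i < 2 ^ g i.
Proof.
  intros H. induction i as [|i IH]; simpl first.
  - apply Nat.neq_0_lt_0, Nat.pow_nonzero. lia.
  - assert (E : 2 ^ S (g i) <= 2 ^ g (S i)).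
    { apply Nat.pow_le_mono_r; [lia|]. apply H. }
    rewrite Nat.pow_succ_r' in E. lia.
Qed.

Lemma testbit_first g i x : increasing g ->
  Nat.testbit (first g i) x = true <-> exists j, j < i /\ x = g j.
Proof.
  intros H. induction i as [|i IH].
  - cbn [first nat_rect]. rewrite Nat.bits_0. split; [discriminate|intros [j [Hj _]]; lia].
  - change (first g (S i)) with (first g i + 2 ^ g i).
    rewrite testbit_pow2_add by now apply first_lt.
    destruct (Nat.eqb_spec x (g i)) as [->|Hx].
    + split; auto. intros _. exists i. split; [lia|auto].
    + rewrite IH. split; intros [j [H1 H2]]; exists j; split; auto.
      destruct (Nat.eq_dec j i); [subst; congruence|lia].
Qed.

Lemma first_mono g i j : increasing g -> i <= j -> bsub (first g i) (first g j).
Proof.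
  intros H Hij x. rewrite !testbit_first by auto.
  intros [k [H1 H2]]. exists k. split; [lia|auto].
Qed.

Lemma first_ext g g' i : (forall j, j < i -> g j = g' j) -> first g i = first g' i.
Proof.
  induction i as [|i IH]; intros H; [reflexivity|].
  change (first g i + 2 ^ g i = first g' i + 2 ^ g' i).
  rewrite IH, H; auto.
Qed.

Lemma evens_odds X i : set_infinite X -> evens X i < odds X i /\ odds X i < evens X (S i).
Proof.
  intros H. unfold evens, odds. split.
  - apply (nx_spec X (S (nx X (pos X i))) H).
  - apply (nx_spec X (pos X (S i)) H).
Qed.

Lemma evens_increasing X : set_infinite X -> increasing (evens X).
Proof. intros H i. destruct (evens_odds X i H). lia. Qed.

Lemma odds_increasing X : set_infinite X -> increasing (odds X).
Proof. intros H i. destruct (evens_odds X i H), (evens_odds X (S i) H). lia. Qed.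

Lemma evens_in X i : set_infinite X -> X (evens X i) = true.
Proof. intros H. apply nx_spec; auto. Qed.

Lemma odds_in X i : set_infinite X -> X (odds X i) = true.
Proof. intros H. apply nx_spec; auto. Qed.

Lemma nx_local X Y k w : set_infinite X ->
  (forall x, x < w -> Y x = X x) -> nx X k < w -> nx Y k = nx X k.
Proof.
  intros HX HXY Hw. apply mu_eq.
  - destruct (nx_spec X k HX) as [H1 [H2 _]].
    now rewrite HXY, H2, (proj2 (Nat.leb_le _ _) H1).
  - intros m Hm. rewrite HXY by lia.
    destruct (Nat.leb_spec k m); auto. simpl.
    apply not_true_is_false. intros E.
    destruct (nx_spec X k HX) as [_ [_ H3]]. specialize (H3 m H E). lia.
Qed.

Lemma samples_local X Y i w : set_infinite X ->
  (forall x, x < w -> Y x = X x) -> pos X i <= w ->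
  pos Y i = pos X i /\ forall j, j < i -> evens Y j = evens X j /\ odds Y j = odds X j.
Proof.
  intros HX HXY. induction i as [|i IH]; intros Hw.
  - split; [reflexivity|lia].
  - change (pos X (S i)) with (S (odds X i)) in *.
    change (pos Y (S i)) with (S (odds Y i)).
    destruct (evens_odds X i HX) as [E1 _].
    assert (E2 : pos X i <= evens X i) by apply (nx_spec X (pos X i) HX).
    destruct IH as [I1 I2]; [lia|].
    assert (Ee : evens Y i = evens X i).
    { unfold evens. rewrite I1. apply nx_local with w; auto. fold (evens X i). lia. }
    assert (Eo : odds Y i = odds X i).
    { unfold odds. fold (evens Y i) (evens X i). rewrite Ee.
      now apply nx_local with w. }
    split; [now rewrite Eo|]. intros j Hj.
    destruct (Nat.eq_dec j i) as [->|Hne]; [auto|apply I2; lia].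
Qed.

Section SampleComp.
Variable Cl : (nat -> bool) -> Prop.
Hypothesis Clinf : forall X, Cl X -> set_infinite X.

Lemma comp_nx n k : comp Cl n k -> comp Cl n (fun X v => nx X (k X v)).
Proof.
  apply (comp_app1 Cl n nx). unfold nx.
  apply comp_mu with (p := fun X v x => (nth 0 v 0 <=? x) && X x).
  - cbv beta. comp_auto.
  - intros X v HX _. destruct (Clinf X HX (nth 0 v 0)) as [x [H1 H2]].
    exists x. now rewrite (proj2 (Nat.leb_le _ _) H1), H2.
Qed.

Lemma comp_nx_tail n t k :
  comp Cl n t -> comp Cl n k -> comp Cl n (fun X v => nx (tail X (t X v)) (k X v)).
Proof.
  apply (comp_app2 Cl n (fun X t k => nx (tail X t) k)). unfold nx, tail.
  apply comp_mu with (p := fun X v x =>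
    (nth 1 v 0 <=? x) && ((nth 0 v 0 <? x) && X x)).
  - cbv beta. comp_auto.
  - intros X v HX _.
    destruct (tail_infinite X (nth 0 v 0) (Clinf X HX) (nth 1 v 0)) as [x [H1 H2]].
    exists x. unfold tail in H2. now rewrite (proj2 (Nat.leb_le _ _) H1), H2.
Qed.
Hint Resolve comp_nx_tail : comp.

Lemma comp_pos n t i :
  comp Cl n t -> comp Cl n i -> comp Cl n (fun X v => pos (tail X (t X v)) (i X v)).
Proof.
  apply (comp_app2 Cl n (fun X t i => pos (tail X t) i)). unfold pos. comp_auto.
Qed.
Hint Resolve comp_pos : comp.

Lemma comp_first_evens n t i : comp Cl n t -> comp Cl n i ->
  comp Cl n (fun X v => first (evens (tail X (t X v))) (i X v)).
Proof.
  apply (comp_app2 Cl n (fun X t i => first (evens (tail X t)) i)).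
  unfold first, evens. comp_auto.
Qed.

Lemma comp_first_odds n t i : comp Cl n t -> comp Cl n i ->
  comp Cl n (fun X v => first (odds (tail X (t X v))) (i X v)).
Proof.
  apply (comp_app2 Cl n (fun X t i => first (odds (tail X t)) i)).
  unfold first, odds. comp_auto.
Qed.

End SampleComp.
#[export] Hint Resolve comp_nx comp_nx_tail comp_first_evens comp_first_odds : comp.

Definition uniformly_computes (A B : nat -> bool) : Prop :=
  exists C, set_infinite C /\ subset C B /\
    exists Phi, forall S, set_infinite S -> subset S C -> computes S Phi A.

Lemma uniformly_computes_intro A B C (f : (nat -> bool) -> nat -> bool) :
  set_infinite C -> subset C B ->
  compb (fun S => set_infinite S /\ subset S C) 1 (fun X v => f X (nth 0 v 0)) ->
  (forall S n, set_infinite S -> subset S C -> f S n = A n) ->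
  uniformly_computes A B.
Proof.
  intros HC HCB [c Hc] Hf. exists C. split; [auto|]. split; [auto|].
  exists c. intros S HS HSC n. rewrite <- (Hf S n HS HSC).
  replace (if f S n then 1 else 0) with (Nat.b2n (f S n)) by now destruct (f S n).
  apply (Hc S [n]); auto.
Qed.

(** * Case (b): racing two searches on one set *)

Section CaseB.
Variables A C : nat -> bool.
Variable O : nat -> nat -> bool.
Hypothesis Ocomp : forall Cl n x h, comp Cl n x -> comp Cl n h ->
  compb Cl n (fun X v => O (x X v) (h X v)).
Hypothesis Omono : forall n h h', bsub h h' -> O n h = true -> O n h' = true.
Hypothesis Cinf : set_infinite C.
Hypothesis Osound : forall n h, (forall x, Nat.testbit h x = true -> C x = true) ->
  O n h = true -> A n = true.
Hypothesis Ocomplete : forall X, set_infinite X -> subset X C ->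
  forall n, A n = true -> exists v, O n (mask X v) = true.
Hint Resolve Ocomp : comp.

Lemma first_sound n g i :
  increasing g -> (forall i, C (g i) = true) -> O n (first g i) = true -> A n = true.
Proof.
  intros Hg HgC. apply Osound. intros x Hx. apply testbit_first in Hx; auto.
  destruct Hx as [j [_ ->]]. auto.
Qed.

Lemma first_complete n g :
  increasing g -> (forall i, C (g i) = true) -> A n = true ->
  exists i, O n (first g i) = true.
Proof.
  intros Hg HgC Hn.
  destruct (Ocomplete (fun x => asb (exists j, x = g j))) with (n := n) as [v Hv]; auto.
  - intros m. exists (g m). split; [now apply increasing_ge|]. apply true_asb. now exists m.
  - intros x Hx. apply asb_true in Hx. destruct Hx as [j ->]. auto.
  (* Since [j <= g j], all values of [g] below [v] occur among the first [v]. *)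
  - exists v. revert Hv. apply Omono. intros x. rewrite testbit_mask, andb_true_iff, Nat.ltb_lt.
    intros [H1 H2]. apply asb_true in H2. destruct H2 as [j ->].
    apply testbit_first; auto. exists j. split; auto.
    apply Nat.le_lt_trans with (g j); auto. now apply increasing_ge.
Qed.

(* On [X], the even samples enumerate [n] no later than the odd samples enumerate [m]. *)
Definition precedes (n m : nat) (X : nat -> bool) : Prop :=
  exists i, O m (first (odds X) i) = true /\
    (forall j, j < i -> O m (first (odds X) j) = false) /\
    O n (first (evens X) i) = true.

(** The race is decided by its first [i] rounds, which depend only on [Z] below [pos Z i]. *)
Lemma precedes_open n m Z : set_infinite Z -> precedes n m Z ->
  exists v, forall Y, set_infinite Y -> (forall x, x < v -> Y x = Z x) -> precedes n m Y.
Proof.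
  intros HZ [i [H1 [H2 H3]]]. exists (pos Z i). intros Y HY HYZ.
  destruct (samples_local Z Y i (pos Z i) HZ HYZ (le_n _)) as [_ E].
  exists i. split; [|split].
  - rewrite (first_ext (odds Y) (odds Z)); [auto|]. intros j Hj. now apply E.
  - intros j Hj. rewrite (first_ext (odds Y) (odds Z)); [auto|].
    intros k Hk. apply E. lia.
  - rewrite (first_ext (evens Y) (evens Z)); [auto|]. intros j Hj. now apply E.
Qed.

(** Fusion settles finitely many pairs at each [k], so a pair is homogeneous above those elements of
    [C1] that bound it. An algorithm handling [n] and [m] accordingly begins at [nx S (n + m)]. *)
Lemma homogenize : exists C1, set_infinite C1 /\ subset C1 C /\
  forall k, C1 k = true -> forall n m, n <= k -> m <= k ->
    (forall Z, set_infinite Z -> subset Z (tail C1 k) -> precedes n m Z) \/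
    (forall Z, set_infinite Z -> subset Z (tail C1 k) -> ~ precedes n m Z).
Proof.
  set (Q := fun n m Y =>
    (forall Z, set_infinite Z -> subset Z Y -> precedes n m Z) \/
    (forall Z, set_infinite Z -> subset Z Y -> ~ precedes n m Z)).
  assert (HQ : forall n m, hereditary (Q n m)).
  { intros n m X Y HY HYX [H|H]; [left|right]; intros Z HZ HZY; apply H; auto;
      now apply subset_trans with Y. }
  assert (HQk : forall k n, hereditary (fun Y => forall m, m < S k -> Q n m Y)).
  { intros k n X Y HY HYX H m Hm. apply HQ with X; auto. }
  destruct (fusion (fun k Y => forall n, n < S k -> forall m, m < S k -> Q n m Y) C Cinf)
    as [C1 [H1 [H2 H3]]].
  - intros k. apply (dense_finite C (fun n Y => forall m, m < S k -> Q n m Y)); auto.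
    intros n _. apply (dense_finite C (fun m Y => Q n m Y)); auto.
    intros m _ X HX _. exact (open_ramsey (precedes n m) (precedes_open n m) X HX).
  - intros k X Y HY HYX H n Hn. apply HQk with X; auto.
  - exists C1. split; [auto|]. split; [auto|]. intros k Hk n m Hn Hm.
    apply (H3 k Hk n ltac:(lia) m ltac:(lia)).
Qed.

(** With [m] in [A] the odd search terminates, which makes the existential [precedes] decidable from
    [Z]. *)
Lemma precedes_search n m Z : set_infinite Z -> subset Z C -> A m = true ->
  (precedes n m Z <->
   O n (first (evens Z) (mu (fun i => O m (first (odds Z) i)))) = true).
Proof.
  intros HZ HZC Hm.
  destruct (mu_spec (fun i => O m (first (odds Z) i))) as [M1 M2].
  { apply first_complete; auto.
    - now apply odds_increasing.
    - intros i. apply HZC. now apply odds_in. }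
  split.
  - intros [i [H1 [H2 H3]]].
    rewrite (mu_eq (fun i => O m (first (odds Z) i)) i); auto.
  - intros H. exists (mu (fun i => O m (first (odds Z) i))). auto.
Qed.

Hypothesis Ainf : set_infinite A.
Hypothesis Ace : forall S, set_infinite S -> subset S A -> ce_in S A.

Lemma case_b : uniformly_computes A C.
Proof.
  destruct homogenize as [C1 [I1 [S1 Hom]]].
  (* [T] is the eventual outcome of the race; [HT] lets every infinite set far enough out read it
     off. *)
  set (T := fun n m => exists k, forall Z,
    set_infinite Z -> subset Z (tail C1 k) -> precedes n m Z).
  assert (HT : forall n m k Z, C1 k = true -> n <= k -> m <= k ->
    set_infinite Z -> subset Z (tail C1 k) -> (T n m <-> precedes n m Z)).
  { intros n m k Z Hk Hn Hm HZ HZk. destruct (Hom k Hk n m Hn Hm) as [H|H].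
    - split; [auto|]. intros _. exists k. auto.
    - split; [|intros HP; elim (H Z HZ HZk HP)].
      (* Opposite verdicts would meet on [tail Z k'], which lies in both tails. *)
      intros [k' Hk']. exfalso. apply (H (tail Z k')).
      + now apply tail_infinite.
      + apply subset_trans with Z; auto. apply tail_subset.
      + apply Hk'; [now apply tail_infinite|]. apply tail_mono.
        apply subset_trans with (tail C1 k); auto. apply tail_subset. }
  assert (HtC : forall Z k, subset Z (tail C1 k) -> subset Z C).
  { intros Z k H. apply subset_trans with (tail C1 k); auto.
    apply subset_trans with C1; auto. apply tail_subset. }
  destruct (classic (exists m, A m = true /\
    forall b, exists n, b <= n /\ A n = true /\ T n m)) as [[m [Hm Hinf]]|Hno].
  - set (H := fun n => asb (T n m)).
    assert (HA : subset H A).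
    { intros n Hn. apply asb_true in Hn. destruct Hn as [k Hk].
      destruct (Hk (tail C1 k)) as [i [_ [_ Hi]]].
      - now apply tail_infinite.
      - apply subset_refl.
      - revert Hi. apply first_sound.
        + apply evens_increasing. now apply tail_infinite.
        + intros j. apply (HtC (tail C1 k) k (subset_refl _)).
          apply evens_in. now apply tail_infinite. }
    assert (Hi : set_infinite H).
    { intros b. destruct (Hinf b) as [n [N1 [_ N3]]]. exists n.
      split; [auto|]. now apply true_asb. }
    destruct (Ace H Hi HA) as [e He].
    (* Sparseness: an element of [C2] past [k] is a stage by which [e], with oracle [H], has
       enumerated every [n <= k] in [A]. *)
    destruct (fusion (fun k Y => forall n, n < S k -> A n = true ->
      forall x, Y x = true -> evn x H e [n] <> 0) C1 I1) as [C2 [I2 [S2 H2]]].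
    + intros k. apply (dense_finite C1 (fun n Y => A n = true ->
        forall x, Y x = true -> evn x H e [n] <> 0)).
      * intros n _ X HX _. destruct (A n) eqn:E.
        -- apply He in E. destruct E as [y Hy]. apply eval_complete in Hy.
           destruct Hy as [t Ht]. exists (tail X t). split; [now apply tail_infinite|].
           split; [apply tail_subset|]. intros _ x Hx. apply tail_spec in Hx.
           rewrite (evn_mono t x H H e) with (y := y); auto. lia.
        -- exists X. split; [auto|]. split; [apply subset_refl|]. discriminate.
      * intros n X Y _ HYX HX Hn x Hx. auto.
    + intros k X Y _ HYX HX n Hk Hn x Hx. auto.
    + set (h := fun S n => let k := nx S (n + m) in
        O n (first (evens (tail S k)) (mu (fun i => O m (first (odds (tail S k)) i))))).
      (* Two elements of [S] are taken: the first bounds [n], and the second, beyond it, is a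
         sufficient stage. *)
      apply uniformly_computes_intro with C2 (fun S n =>
        let t := nx S (Datatypes.S (nx S n)) in
        1 <=? evn t (Nat.testbit (mask (h S) t)) e [n]).
      * auto.
      * apply subset_trans with C1; auto.
      * set (Cl := fun S => set_infinite S /\ subset S C2).
        assert (Clinf : forall X, Cl X -> set_infinite X) by (intros X HX; apply HX).
        assert (Hmu : forall n t, comp Cl n t ->
          comp Cl n (fun X v => mu (fun i => O m (first (odds (tail X (t X v))) i)))).
        { intros n t. apply (comp_app1 Cl n (fun X t =>
            mu (fun i => O m (first (odds (tail X t)) i)))).
          apply comp_mu with (p := fun X v i => O m (first (odds (tail X (nth 0 v 0))) i)).
          - cbv beta. comp_auto.
          - intros X v [HX1 HX2] _. apply first_complete; auto.
            + now apply odds_increasing, tail_infinite.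
            + intros i. apply S1, S2, HX2. apply (tail_subset X (nth 0 v 0)).
              apply odds_in. now apply tail_infinite. }
        cbv zeta. unfold h. comp_auto.
      * intros S n HS HSC. cbv zeta.
        set (k := nx S n). set (t := nx S (Datatypes.S k)).
        destruct (nx_spec S n HS) as [K1 [K2 _]]. fold k in K1, K2.
        destruct (nx_spec S (Datatypes.S k) HS) as [T1 [T2 _]]. fold t in T1, T2.
        assert (Hh : forall n, h S n = H n).
        { intros n'. unfold h. cbv zeta. set (k' := nx S (n' + m)).
          destruct (nx_spec S (n' + m) HS) as [K1' [K2' _]]. fold k' in K1', K2'.
          assert (Ht : subset (tail S k') (tail C1 k')).
          { apply tail_mono. apply subset_trans with C2; auto. }
          apply eq_iff_eq_true. unfold H. rewrite asb_spec.
          rewrite (HT n' m k' (tail S k')); auto; try lia.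
          - symmetry. apply precedes_search; auto.
            + now apply tail_infinite.
            + now apply HtC with k'.
          - now apply tail_infinite. }
        rewrite (mask_ext (h S) H) by auto.
        assert (Ha : forall x, x < t -> Nat.testbit (mask H t) x = H x).
        { intros x Hx. rewrite testbit_mask, (proj2 (Nat.ltb_lt x t)); auto. }
        apply eq_iff_eq_true. rewrite Nat.leb_le. split.
        -- intros E. destruct (evn t (Nat.testbit (mask H t)) e [n]) as [|y] eqn:E';
             [lia|]. apply He. exists y.
           apply (evn_sound t (Nat.testbit (mask H t)) H e); auto.
           intros x Hx. symmetry. auto.
        -- intros Hn. assert (E : evn t H e [n] <> 0).
           { apply (H2 k); auto; [lia|]. apply tail_spec. split; [lia|auto]. }
           destruct (evn t H e [n]) as [|y] eqn:E'; [congruence|].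
           rewrite (evn_mono t t H (Nat.testbit (mask H t)) e) with (y := y); auto; [lia|].
           intros x Hx. symmetry. auto.
  - assert (Hg : forall m, A m = true -> exists b, forall n, b <= n -> A n = true -> ~ T n m).
    { intros m Hm. apply NNPP. intros Hb. apply Hno. exists m. split; [auto|].
      intros b. apply NNPP. intros Hn. apply Hb. exists b. intros n Hn1 Hn2 Hn3.
      apply Hn. now exists n. }
    (* For [m <= k] in [A], an element of [C2] past [k] lies beyond every [n] in [A] with
       [T n m]. *)
    destruct (fusion (fun k Y => forall m, m < S k -> A m = true ->
      forall x, Y x = true -> forall n, x <= n -> A n = true -> ~ T n m) C1 I1)
      as [C2 [I2 [S2 H2]]].
    + intros k. apply (dense_finite C1 (fun m Y => A m = true ->
        forall x, Y x = true -> forall n, x <= n -> A n = true -> ~ T n m)).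
      * intros m _ X HX _. destruct (A m) eqn:E.
        -- destruct (Hg m E) as [b Hb]. exists (tail X b).
           split; [now apply tail_infinite|]. split; [apply tail_subset|].
           intros _ x Hx n Hn. apply tail_spec in Hx. apply Hb. lia.
        -- exists X. split; [auto|]. split; [apply subset_refl|]. discriminate.
      * intros m X Y _ HYX HX Hm x Hx. exact (HX Hm x (HYX x Hx)).
    + intros k X Y _ HYX HX m Hk Hm x Hx. exact (HX m Hk Hm x (HYX x Hx)).
    (* The search for a member of [A] that is at least [x] is dovetailed: [v] bounds both the
       candidate [n] and the part of [S] consulted. *)
    + set (r := fun S x v n => (x <=? n) && O n (mask S v)).
      set (w := fun S x => mu (fun v => bex v (r S x v))).
      set (q := fun S x => bmin (w S x) (r S x (w S x))).
      set (i := fun S n k => mu (fun i => O n (first (evens (tail S k)) i))).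
      assert (HS1 : forall S, subset S C2 -> subset S C1).
      { intros S H. now apply subset_trans with C2. }
      assert (HSC : forall S, subset S C2 -> subset S C).
      { intros S H. apply subset_trans with C1; auto. }
      assert (Hw : forall S x, set_infinite S -> subset S C2 ->
        exists v, bex v (r S x v) = true).
      { intros S x HS HSC2. destruct (Ainf x) as [n [N1 N2]].
        destruct (Ocomplete S HS (HSC S HSC2) n N2) as [v Hv].
        exists (v + Datatypes.S n). apply bex_spec. exists n. split; [lia|].
        unfold r. rewrite (proj2 (Nat.leb_le x n)) by auto. simpl.
        revert Hv. apply Omono. apply bsub_mask. intros y Hy. split; [lia|auto]. }
      assert (Hq : forall S x, set_infinite S -> subset S C2 ->
        x <= q S x /\ A (q S x) = true).
      { intros S x HS HSC2. destruct (mu_spec _ (Hw S x HS HSC2)) as [M1 _].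
        fold (w S x) in M1. unfold bex in M1. apply Nat.ltb_lt in M1.
        destruct (bmin_spec (w S x) (r S x (w S x))) as [[_ [M2 _]]|[M2 _]]; [|lia].
        fold (q S x) in M2. unfold r in M2. apply andb_true_iff in M2.
        destruct M2 as [M2 M3]. apply Nat.leb_le in M2. split; [auto|].
        revert M3. apply Osound. intros y. rewrite testbit_mask.
        intros Hy. apply (HSC S HSC2). now destruct (y <? w S x). }
      (* The search for [m] along the odd samples is cut off where the even samples reach a witness
         for the large member [n]. *)
      apply uniformly_computes_intro with C2 (fun S m =>
        let n := q S (nx S (Datatypes.S (nx S m))) in
        let k := nx S (n + m) in
        O m (first (odds (tail S k)) (i S n k))).
      * auto.
      * apply subset_trans with C1; auto.
      * set (Cl := fun S => set_infinite S /\ subset S C2).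
        assert (Clinf : forall X, Cl X -> set_infinite X) by (intros X HX; apply HX).
        assert (Hqc : comp Cl 1 (fun X v => q X (nth 0 v 0))).
        { assert (Hwc : comp Cl 1 (fun X v => w X (nth 0 v 0))).
          { apply comp_mu with (p := fun X v u => bex u (r X (nth 0 v 0) u)).
            - cbv beta. unfold r. comp_auto.
            - intros X v [HX1 HX2] _. now apply Hw. }
          apply (comp_app2 Cl 1 (fun X x u => bmin u (r X x u)) (fun _ v => nth 0 v 0));
            [unfold r; comp_auto|comp_auto|exact Hwc]. }
        set (n := fun (X : nat -> bool) m => q X (nx X (Datatypes.S (nx X m)))).
        assert (Hn : comp Cl 1 (fun X v => n X (nth 0 v 0))).
        { apply (comp_app1 Cl 1 q); [exact Hqc|comp_auto]. }
        set (k := fun X m => nx X (n X m + m)).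
        assert (Hk : comp Cl 1 (fun X v => k X (nth 0 v 0))) by (unfold k; comp_auto).
        assert (Hic : comp Cl 1 (fun X v => i X (n X (nth 0 v 0)) (k X (nth 0 v 0)))).
        { apply comp_mu with (p := fun X v j =>
            O (n X (nth 0 v 0)) (first (evens (tail X (k X (nth 0 v 0)))) j)).
          - cbv beta.
            assert (Hn' : comp Cl 2 (fun X v => n X (nth 0 (List.tl v) 0))).
            { apply (comp_app1 Cl 2 n); [exact Hn|comp_auto]. }
            assert (Hk' : comp Cl 2 (fun X v => k X (nth 0 (List.tl v) 0))).
            { apply (comp_app1 Cl 2 k); [exact Hk|comp_auto]. }
            comp_auto.
          - intros X v [HX1 HX2] _. apply first_complete.
            + now apply evens_increasing, tail_infinite.
            + intros j. apply (HSC X HX2), (tail_subset X (k X (nth 0 v 0))).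
              apply evens_in. now apply tail_infinite.
            + now apply Hq. }
        cbv zeta. apply Ocomp; [comp_auto|].
        apply comp_first_odds; [exact Clinf|exact Hk|exact Hic].
      * intros S m HS HSC2. cbv zeta.
        set (k0 := nx S m). set (x := nx S (Datatypes.S k0)).
        destruct (nx_spec S m HS) as [K1 [K2 _]]. fold k0 in K1, K2.
        destruct (nx_spec S (Datatypes.S k0) HS) as [X1 [X2 _]]. fold x in X1, X2.
        destruct (Hq S x HS HSC2) as [Q1 Q2]. set (n := q S x) in *.
        destruct (nx_spec S (n + m) HS) as [K1' [K2' _]]. set (k := nx S (n + m)) in *.
        assert (Ht : subset (tail S k) (tail C1 k)) by (apply tail_mono; auto).
        assert (Hi : set_infinite (tail S k)) by now apply tail_infinite.
        assert (HtC' : subset (tail S k) C) by now apply HtC with k.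
        assert (Hev : increasing (evens (tail S k))) by now apply evens_increasing.
        assert (Hod : increasing (odds (tail S k))) by now apply odds_increasing.
        destruct (A m) eqn:Hm.
        -- assert (HnT : ~ T n m).
           { apply (H2 k0 (HSC2 _ K2) m) with x; auto; [lia|].
             apply tail_spec. split; [lia|auto]. }
           assert (HnP : ~ precedes n m (tail S k)).
           { rewrite <- (HT n m k (tail S k)); auto; lia. }
           rewrite precedes_search in HnP by auto.
           destruct (mu_spec (fun j => O n (first (evens (tail S k)) j))) as [M1 _].
           { apply first_complete; auto. intros j. apply HtC'. now apply evens_in. }
           fold (i S n k) in M1.
           destruct (mu_spec (fun j => O m (first (odds (tail S k)) j))) as [M2 _].
           { apply first_complete; auto. intros j. apply HtC'. now apply odds_in. }
           (* If [n] were found no later than [m], monotonicity would give [precedes n m]. *)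
           destruct (le_lt_dec (i S n k) (mu (fun j => O m (first (odds (tail S k)) j))))
             as [Hle|Hlt].
           ++ exfalso. apply HnP. revert M1. apply Omono. now apply first_mono.
           ++ revert M2. apply Omono. apply first_mono; auto. lia.
        -- apply not_true_is_false. intros E. apply first_sound in E; auto; [congruence|].
           intros j. apply HtC'. now apply odds_in.
Qed.

End CaseB.

(** * The lexicographic order on finite sets *)

(* For finite sets this is the Kleene-Brouwer order of their increasing enumerations:
   the least point of difference belongs to the smaller set. *)
Definition lexlt (a b : nat) : bool :=
  bex a (fun x => (Nat.testbit a x && negb (Nat.testbit b x)) &&
    ball x (fun y => if Nat.testbit a y then Nat.testbit b y else negb (Nat.testbit b y))).

Lemma lexlt_spec a b : lexlt a b = true <-> exists x,
  Nat.testbit a x = true /\ Nat.testbit b x = false /\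
  forall y, y < x -> Nat.testbit a y = Nat.testbit b y.
Proof.
  unfold lexlt. rewrite bex_spec. split.
  - intros [x [_ H]]. rewrite !andb_true_iff, negb_true_iff, ball_spec in H.
    destruct H as [[H1 H2] H3]. exists x. split; [auto|]. split; [auto|].
    intros y Hy. specialize (H3 y Hy).
    destruct (Nat.testbit a y), (Nat.testbit b y); auto.
  - intros [x [H1 [H2 H3]]]. exists x. split; [now apply testbit_lt|].
    rewrite !andb_true_iff, negb_true_iff, ball_spec. split; [auto|].
    intros y Hy. rewrite H3 by auto. now destruct (Nat.testbit b y).
Qed.

Lemma compb_lexlt Cl n a b :
  comp Cl n a -> comp Cl n b -> compb Cl n (fun X v => lexlt (a X v) (b X v)).
Proof.
  apply (comp_app2 Cl n (fun X a b => Nat.b2n (lexlt a b))).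
  change (compb Cl 2 (fun X v => lexlt (nth 0 v 0) (nth 1 v 0))).
  unfold lexlt. comp_auto.
Qed.
#[export] Hint Resolve compb_lexlt : comp.

Lemma lexlt_trans a b c : lexlt a b = true -> lexlt b c = true -> lexlt a c = true.
Proof.
  rewrite !lexlt_spec. intros [x [X1 [X2 X3]]] [y [Y1 [Y2 Y3]]].
  destruct (lt_eq_lt_dec x y) as [[H|H]|H].
  - exists x. split; [auto|]. split; [rewrite <- Y3; auto|].
    intros z Hz. rewrite X3, Y3; auto; lia.
  - subst. congruence.
  - exists y. split; [rewrite X3; auto|]. split; [auto|].
    intros z Hz. rewrite X3, Y3; auto; lia.
Qed.

Lemma lexlt_irrefl a : lexlt a a = false.
Proof.
  apply not_true_is_false. rewrite lexlt_spec. intros [x [X1 [X2 _]]]. congruence.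
Qed.

Lemma lexlt_total a b : a <> b -> lexlt a b = true \/ lexlt b a = true.
Proof.
  intros Hne.
  destruct (least_exists (fun x => xorb (Nat.testbit a x) (Nat.testbit b x))) as [x [H1 H2]].
  - apply NNPP. intros H. apply Hne. apply bits_ext. intros x. apply NNPP. intros Hx.
    apply H. exists x. destruct (Nat.testbit a x), (Nat.testbit b x); auto; congruence.
  - assert (H3 : forall y, y < x -> Nat.testbit a y = Nat.testbit b y).
    { intros y Hy. specialize (H2 y Hy).
      destruct (Nat.testbit a y), (Nat.testbit b y); auto; discriminate. }
    destruct (Nat.testbit a x) eqn:Ea, (Nat.testbit b x) eqn:Eb; try discriminate.
    + left. apply lexlt_spec. exists x. auto.
    + right. apply lexlt_spec. exists x. split; [auto|]. split; [auto|].
      intros y Hy. symmetry. auto.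
Qed.

Lemma well_founded_of_min (R : nat -> nat -> Prop) :
  (forall Q : nat -> Prop, (exists a, Q a) -> exists a, Q a /\ forall b, R b a -> ~ Q b) ->
  well_founded R.
Proof.
  intros H a. apply NNPP. intros Ha.
  destruct (H (fun a => ~ Acc R a) (ex_intro _ a Ha)) as [m [M1 M2]].
  apply M1. constructor. intros b Hb. apply NNPP. now apply M2.
Qed.

(** Follow the leftmost branch: at each [v] take the bit 1 if some member of [Q] with the bits so
    far has it. A branch with finitely many ones is itself a member, and the least one; otherwise
    [Q] accumulates at an infinite set. *)
Lemma lex_limit (Q : nat -> Prop) : (exists a, Q a) ->
  (exists a, Q a /\ forall b, Q b -> lexlt b a = false) \/
  (exists X, set_infinite X /\
     forall v, exists a, Q a /\ forall x, x < v -> Nat.testbit a x = X x).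
Proof.
  intros [a0 Ha0].
  set (bit := fun p v => asb (exists a, Q a /\ mask (Nat.testbit a) v = p /\
                                        Nat.testbit a v = true)).
  set (p := nat_rect (fun _ => nat) 0 (fun v p => p + if bit p v then 2 ^ v else 0)).
  set (X := fun v => bit (p v) v).
  assert (Hp : forall v, p v = mask X v).
  { induction v as [|v IH]; [reflexivity|]. cbn [mask]. rewrite <- IH. reflexivity. }
  assert (Hmask : forall Y Z v, mask Y v = mask Z v -> forall x, x < v -> Y x = Z x).
  { intros Y Z v E x Hx. generalize (testbit_mask Y v x), (testbit_mask Z v x).
    rewrite E, (proj2 (Nat.ltb_lt x v) Hx). simpl. congruence. }
  assert (F2 : forall a v, Q a -> (forall x, x < v -> Nat.testbit a x = X x) ->
    Nat.testbit a v = true -> X v = true).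
  { intros a v Ha Hv Hav. apply true_asb. exists a. split; [auto|]. split; [|auto].
    rewrite Hp. now apply mask_ext. }
  assert (F1 : forall v, exists a, Q a /\ forall x, x < v -> Nat.testbit a x = X x).
  { induction v as [|v [a [A1 A2]]]; [exists a0; split; [auto|lia]|].
    destruct (X v) eqn:E.
    - apply asb_true in E as E'. destruct E' as [b [B1 [B2 B3]]]. exists b. split; [auto|].
      intros x Hx. destruct (Nat.eq_dec x v) as [->|Hne]; [congruence|].
      rewrite Hp in B2. apply (Hmask _ _ _ B2). lia.
    - exists a. split; [auto|]. intros x Hx.
      destruct (Nat.eq_dec x v) as [->|Hne]; [|apply A2; lia].
      destruct (Nat.testbit a v) eqn:E'; [|now rewrite E].
      apply F2 in E'; auto. }
  destruct (classic (set_infinite X)) as [Hinf|Hfin]; [right; eauto|left].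
  apply not_all_ex_not in Hfin. destruct Hfin as [v Hv].
  assert (Hv' : forall x, v <= x -> X x = false).
  { intros x Hx. apply not_true_is_false. intros E. apply Hv. now exists x. }
  destruct (F1 v) as [a [A1 A2]].
  assert (A3 : forall x, Nat.testbit a x = X x).
  { induction x as [x IH] using lt_wf_ind. destruct (le_lt_dec v x) as [H|H]; [|auto].
    rewrite Hv' by auto. apply not_true_is_false. intros E.
    apply F2 in E; auto. rewrite Hv' in E; auto. discriminate. }
  exists a. split; [auto|]. intros b Hb. apply not_true_is_false.
  rewrite lexlt_spec. intros [x [X1 [X2 X3]]].
  apply F2 in X1; auto.
  - rewrite <- A3 in X1. congruence.
  - intros y Hy. rewrite <- A3. auto.
Qed.

Lemma finite_max (R : nat -> nat -> Prop) (P : nat -> Prop) z :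
  (forall a b c, R a b -> R b c -> R a c) ->
  (forall a b, P a -> P b -> R a b \/ R b a) ->
  (exists b, b < z /\ P b) ->
  exists b, b < z /\ P b /\ forall c, c < z -> P c -> R c b.
Proof.
  intros Htr Htot. induction z as [|z IH]; intros [b [Hb HP]]; [lia|].
  destruct (classic (exists b, b < z /\ P b)) as [H|H].
  - destruct (IH H) as [m [M1 [M2 M3]]].
    destruct (classic (P z /\ ~ R z m)) as [[Hz Hn]|Hz].
    + exists z. split; [lia|]. split; [auto|]. intros c Hc HPc.
      assert (Hmz : R m z) by (destruct (Htot m z M2 Hz); tauto).
      destruct (Nat.eq_dec c z) as [->|Hne].
      * destruct (Htot z z Hz Hz); auto.
      * apply Htr with m; auto. apply M3; auto. lia.
    + exists m. split; [lia|]. split; [auto|]. intros c Hc HPc.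
      destruct (Nat.eq_dec c z) as [->|Hne]; [|apply M3; auto; lia].
      apply NNPP. tauto.
  - assert (b = z) as ->.
    { destruct (Nat.eq_dec b z); auto. exfalso. apply H. exists b. split; [lia|auto]. }
    exists z. split; [lia|]. split; [auto|]. intros c Hc HPc.
    destruct (Nat.eq_dec c z) as [->|Hne].
    + destruct (Htot z z HP HP); auto.
    + exfalso. apply H. exists c. split; [lia|auto].
Qed.

(** * Case (a): greedy descent through a computable well-order *)

Definition elt (X : nat -> bool) (i : nat) : nat :=
  nat_rect (fun _ => nat) (nx X 0) (fun _ r => nx X (S r)) i.

Lemma elt_increasing X : set_infinite X -> increasing (elt X).
Proof. intros H i. apply (nx_spec X (S (elt X i)) H). Qed.

Lemma elt_in X i : set_infinite X -> X (elt X i) = true.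
Proof. intros H. destruct i; apply (nx_spec X _ H). Qed.

Section CaseA.
Variables A B C : nat -> bool.
Variable O : nat -> nat -> bool.
Variable K : nat -> bool.
Hypothesis Ocomp : forall Cl n x h, comp Cl n x -> comp Cl n h ->
  compb Cl n (fun X v => O (x X v) (h X v)).
Hypothesis Kcomp : forall Cl n h, comp Cl n h -> compb Cl n (fun X v => K (h X v)).
Hypothesis Omono : forall n h h', bsub h h' -> O n h = true -> O n h' = true.
Hypothesis Kmono : forall h h', bsub h h' -> K h' = true -> K h = true.
Hypothesis Cinf : set_infinite C.
Hypothesis CB : subset C B.
Hypothesis CK : forall v, K (mask C v) = true.
Hypothesis Osound : forall n h, (forall x, Nat.testbit h x = true -> C x = true) ->
  O n h = true -> A n = true.
Hypothesis Ocomplete : forall X, set_infinite X -> subset X B ->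
  (forall v, K (mask X v) = true) ->
  forall n, A n = true -> exists v, O n (mask X v) = true.
Variable e : code.
Hypothesis He : forall n, A n = true <-> exists y, eval B e [n] y.
Hint Resolve Ocomp Kcomp : comp.

(* The nodes [h + 2 ^ n] with a fixed [n] form the tree of finite sets [h] that could still be
   extended to an infinite set not enumerating [n]; the elements of [h] witness [n] in [A]. *)
Definition node (X : nat -> bool) (a : nat) : bool :=
  bex (S a) (fun n => bex (S a) (fun h => (a =? h + 2 ^ n) &&
    (ball (S n) (fun x => negb (Nat.testbit h x)) &&
    (ball h (fun x => negb (Nat.testbit h x) ||
       (X x && (1 <=? evn x (Nat.testbit (mask X x)) e [n]))) &&
    (K h && negb (O n h)))))).

Lemma node_spec a : node B a = true <-> exists n h, a = h + 2 ^ n /\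
  (forall x, Nat.testbit h x = true -> n < x /\ B x = true /\ evn x B e [n] <> 0) /\
  K h = true /\ O n h = false.
Proof.
  (* Stage [x] asks only below [x], so a finite mask may replace the oracle [B]. *)
  assert (Hev : forall x n, evn x (Nat.testbit (mask B x)) e [n] <> 0 <-> evn x B e [n] <> 0).
  { intros x n. assert (E : forall y, y < x -> Nat.testbit (mask B x) y = B y).
    { intros y Hy. rewrite testbit_mask, (proj2 (Nat.ltb_lt y x)); auto. }
    split; intros H.
    - destruct (evn x (Nat.testbit (mask B x)) e [n]) as [|y] eqn:E'; [congruence|].
      rewrite (evn_mono x x (Nat.testbit (mask B x)) B e) with (y := y); auto.
    - destruct (evn x B e [n]) as [|y] eqn:E'; [congruence|].
      rewrite (evn_mono x x B (Nat.testbit (mask B x)) e) with (y := y); auto.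
      intros z Hz. symmetry. auto. }
  unfold node. rewrite bex_spec. split.
  - intros [n [_ H]]. apply bex_spec in H. destruct H as [h [_ H]].
    rewrite !andb_true_iff, Nat.eqb_eq, !ball_spec, negb_true_iff in H.
    destruct H as [H1 [H2 [H3 [H4 H5]]]]. exists n, h. split; [auto|].
    split; [|auto]. intros x Hx. split.
    + destruct (le_lt_dec x n) as [Hle|]; auto.
      specialize (H2 x ltac:(lia)). rewrite Hx in H2. discriminate.
    + specialize (H3 x (testbit_lt _ _ Hx)). rewrite Hx in H3. cbn [negb orb] in H3.
      apply andb_true_iff in H3. destruct H3 as [H3 H6]. split; [auto|].
      apply Hev. apply Nat.leb_le in H6. lia.
  - intros [n [h [H1 [H2 [H3 H4]]]]]. exists n.
    assert (n < 2 ^ n) by (apply Nat.pow_gt_lin_r; lia).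
    split; [lia|]. apply bex_spec. exists h. split; [lia|].
    rewrite !andb_true_iff, Nat.eqb_eq, !ball_spec, negb_true_iff.
    split; [auto|]. split; [|split; [|auto]].
    + intros x Hx. apply negb_true_iff, not_true_is_false. intros E.
      apply H2 in E. lia.
    + intros x _. destruct (Nat.testbit h x) eqn:E; auto. cbn [negb orb].
      destruct (H2 x E) as [_ [E1 E2]]. rewrite E1. cbn [andb].
      apply Hev in E2. apply Nat.leb_le. lia.
Qed.

Lemma compb_node Cl n a : comp Cl n a -> compb Cl n (fun X v => node X (a X v)).
Proof.
  apply (comp_app1 Cl n (fun X a => Nat.b2n (node X a))).
  change (compb Cl 1 (fun X v => node X (nth 0 v 0))). unfold node. comp_auto.
Qed.
Hint Resolve compb_node : comp.

Lemma node_bits n h x : (forall x, Nat.testbit h x = true -> n < x) ->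
  Nat.testbit (h + 2 ^ n) x = if x =? n then true else Nat.testbit h x.
Proof.
  intros H.
  assert (E : forall y, Nat.testbit (2 ^ n) y = (y =? n)).
  { intros y. rewrite Nat.pow2_bits_eqb. apply Nat.eqb_sym. }
  rewrite Nat.add_nocarry_lxor.
  - rewrite Nat.lxor_spec, E. destruct (Nat.eqb_spec x n) as [->|Hx].
    + destruct (Nat.testbit h n) eqn:E'; auto. apply H in E'. lia.
    + apply xorb_false_r.
  - apply Nat.bits_inj_0. intros y. rewrite Nat.land_spec, E.
    destruct (Nat.eqb_spec y n) as [->|Hy]; [|apply andb_false_r].
    destruct (Nat.testbit h n) eqn:E'; auto. apply H in E'. lia.
Qed.

Definition tree_order (a b : nat) : Prop :=
  node B a = true /\ node B b = true /\ (a = b \/ lexlt a b = true).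

(** A set of nodes without least element has by [lex_limit] an infinite limit, whose least element
    [n] names the tree and whose rest is a path. The certificates in [node] force [n] into [A],
    where [Ocomplete] finds a witness on the path; for [n] outside [A] nothing else would stop a
    path. *)
Lemma tree_order_wf : well_founded (fun a b => tree_order a b /\ a <> b).
Proof.
  apply well_founded_of_min. intros Q HQ.
  destruct (classic (exists a, Q a /\ node B a = false)) as [[a [Ha Hn]]|Hnodes].
  { exists a. split; [auto|]. intros b [[_ [H _]] _]. congruence. }
  destruct (lex_limit Q HQ) as [[a [A1 A2]]|[X [X1 X2]]].
  { exists a. split; [auto|]. intros b [[_ [_ [H|H]]] Hne] Hb; [contradiction|].
    rewrite A2 in H; auto. discriminate. }
  exfalso.
  destruct (nx_spec X 0 X1) as [_ [N1 N2]]. set (n := nx X 0) in *.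
  set (Y := tail X n).
  assert (Y1 : set_infinite Y) by now apply tail_infinite.
  assert (HY : forall v, exists h, bsub (mask Y v) h /\
    (forall x, Nat.testbit h x = true -> n < x /\ B x = true /\ evn x B e [n] <> 0) /\
    K h = true /\ O n h = false).
  { intros v. destruct (X2 (v + S n)) as [a [A1 A2]].
    destruct (node B a) eqn:E; [|elim Hnodes; eauto].
    apply node_spec in E. destruct E as [n' [h [E1 [E2 [E3 E4]]]]].
    assert (Hb : forall x, Nat.testbit a x = if x =? n' then true else Nat.testbit h x).
    { intros x. subst a. apply node_bits. intros y Hy. now apply E2. }
    assert (n' = n) as ->.
    { apply Nat.le_antisymm.
      - assert (Hn : Nat.testbit a n = true) by (rewrite A2; auto; lia).
        rewrite Hb in Hn. destruct (Nat.eqb_spec n n'); [lia|].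
        apply E2 in Hn. lia.
      - destruct (le_lt_dec n n') as [Hle|Hlt]; auto. apply N2; [lia|].
        rewrite <- A2 by lia. rewrite Hb, Nat.eqb_refl. auto. }
    exists h. split; [|auto]. intros x. rewrite testbit_mask, andb_true_iff, Nat.ltb_lt.
    intros [H1 H2]. apply tail_spec in H2. destruct H2 as [H2 H3].
    rewrite <- A2 in H3 by lia. rewrite Hb in H3.
    destruct (Nat.eqb_spec x n); [lia|auto]. }
  assert (HYx : forall x, Y x = true -> B x = true /\ evn x B e [n] <> 0).
  { intros x Hx. destruct (HY (S x)) as [h [H1 [H2 _]]]. apply H2, H1.
    rewrite testbit_mask, Hx, (proj2 (Nat.ltb_lt x (S x))); auto. }
  assert (Hn : A n = true).
  { destruct (Y1 0) as [x [_ Hx]]. apply HYx in Hx. destruct Hx as [_ Hx].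
    destruct (evn x B e [n]) as [|y] eqn:E; [congruence|]. apply He. exists y.
    now apply evn_sound with x B. }
  destruct (Ocomplete Y Y1) with (n := n) as [v Hv]; auto.
  - intros x Hx. now apply HYx.
  - intros v. destruct (HY v) as [h [H1 [_ [H3 _]]]]. now apply Kmono with h.
  - destruct (HY v) as [h [H1 [_ [_ H4]]]]. rewrite (Omono n _ h H1 Hv) in H4. discriminate.
Qed.

Lemma tree_order_computable : comp_well_order B tree_order.
Proof.
  split.
  - split; [|split; [|split; [|split]]].
    + intros a b [H1 [H2 _]]. unfold field, tree_order. auto.
    + intros a b [_ [_ [H|H]]] [_ [_ [H'|H']]]; auto.
      generalize (lexlt_trans _ _ _ H H'). rewrite lexlt_irrefl. discriminate.
    + intros a b c [H1 [H2 H3]] [_ [H4 H5]]. split; [auto|]. split; [auto|].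
      destruct H3 as [->|H3]; auto. destruct H5 as [<-|H5]; auto.
      right. now apply lexlt_trans with b.
    + intros a b [Ha _] [Hb _]. unfold tree_order.
      destruct (Nat.eq_dec a b) as [->|Hne]; [auto|].
      destruct (lexlt_total a b Hne); auto.
    + exact tree_order_wf.
  - set (r := fun X a b => node X a && (node X b && ((a =? b) || lexlt a b))).
    assert (Hr : compb (fun _ => True) 2 (fun X v => r X (nth 0 v 0) (nth 1 v 0))).
    { unfold r. comp_auto. }
    destruct Hr as [c Hc]. exists c. intros a b.
    specialize (Hc B [a; b] I eq_refl). cbn [nth] in Hc.
    assert (E : r B a b = true <-> tree_order a b).
    { unfold r, tree_order. now rewrite !andb_true_iff, orb_true_iff, Nat.eqb_eq. }
    destruct (r B a b) eqn:Er; split; intros H; auto.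
    + elim H. now apply E.
    + apply E in H. discriminate.
Qed.

Hypothesis Hck : omega1_eq_ck B.

Lemma case_a : uniformly_computes A C.
Proof.
  destruct (Hck tree_order tree_order_computable) as [R [[HR [eR HeR]] [f [Hf1 [Hf2 _]]]]].
  destruct HR as [R1 [R2 [R3 [R4 R5]]]].
  set (r := fun a b => asb (R a b)).
  assert (Hr : forall Cl n a b, comp Cl n a -> comp Cl n b ->
    compb Cl n (fun X v => r (a X v) (b X v))).
  { intros Cl n a b. apply (comp_app2 Cl n (fun X a b => Nat.b2n (r a b))).
    exists (deorac eR). intros X [|x [|y [|? ?]]] _ Hv; try discriminate. cbn [nth].
    apply eval_deorac. unfold r, asb.
    destruct (excluded_middle_informative (R x y)); now apply HeR. }
  (* [f] may be noncomputable, since only its growth matters. The gaps also exceed stages at which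
     [e] enumerates the [n <= k] in [A], so that finite parts of [S] carry the certificates of a
     node. *)
  destruct (fusion (fun k Y => forall n, n < S k -> A n = true -> forall h, h < 2 ^ S k ->
      forall x, Y x = true -> evn x B e [n] <> 0 /\ f (h + 2 ^ n) < x) C Cinf)
    as [C2 [I2 [S2 H2]]].
  - intros k. apply (dense_finite C (fun n Y => A n = true -> forall h, h < 2 ^ S k ->
      forall x, Y x = true -> evn x B e [n] <> 0 /\ f (h + 2 ^ n) < x)).
    + intros n _ X HX HXC. destruct (A n) eqn:E.
      * apply He in E. destruct E as [y Hy]. apply eval_complete in Hy.
        destruct Hy as [t Ht].
        destruct (dense_finite C (fun h Y =>
          forall x, Y x = true -> evn x B e [n] <> 0 /\ f (h + 2 ^ n) < x) (2 ^ S k))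
          with (X := X) as [Y [Y1 [Y2 Y3]]]; auto.
        -- intros h _ Z HZ _. exists (tail Z (t + f (h + 2 ^ n))).
           split; [now apply tail_infinite|]. split; [apply tail_subset|].
           intros x Hx. apply tail_spec in Hx. split; [|lia].
           rewrite (evn_mono t x B B e) with (y := y); auto. lia.
        -- intros h Z W _ HWZ H x Hx. auto.
        -- exists Y. split; [auto|]. split; auto.
      * exists X. split; [auto|]. split; [apply subset_refl|]. discriminate.
    + intros n X Y _ HYX H Hn h Hh x Hx. auto.
  - intros k X Y _ HYX H n Hk Hn h Hh x Hx. apply (H n Hk Hn h Hh x (HYX x Hx)).
  - (* The state of the greedy descent through [R] is 0 when no descent is left, 1 at the start,
       and b + 2 when the current value is b. *)
    set (cand := fun s b => r b b && ((s =? 1) ||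
      ((2 <=? s) && (r b (s - 2) && negb (b =? s - 2))))).
    (* Taking the [R]-greatest candidate below [z] keeps this descent above any other that obeys the
       same bounds. Without a candidate [bmin] returns [z] and the state becomes 0. *)
    set (next := fun z s => let b := bmin z (fun b => cand s b &&
        ball z (fun c => negb (cand s c) || r c b)) in
      if b <? z then b + 2 else 0).
    set (st := fun Z i => nat_rect (fun _ => nat) 1 (fun j s => next (elt Z j) s) i).
    set (stop := fun n Z => mu (fun i => (st Z i =? 0) || O n (first (elt Z) i))).
    assert (Hcand : forall s b, cand s b = true <->
      R b b /\ (s = 1 \/ exists c, s = c + 2 /\ R b c /\ b <> c)).
    { intros s b. unfold cand, r. rewrite andb_true_iff, orb_true_iff, !andb_true_iff, !asb_spec,
        Nat.eqb_eq, Nat.leb_le, negb_true_iff, Nat.eqb_neq.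
      split; intros [H1 H3]; (split; [auto|]); destruct H3 as [H3|H3]; auto; right.
      - exists (s - 2). destruct H3 as [H3 [H4 H5]]. split; [lia|auto].
      - destruct H3 as [c [-> [H3 H4]]]. rewrite Nat.add_sub. split; [lia|auto]. }
    assert (Hnext : forall z s, next z s = 0 \/
      exists b, next z s = b + 2 /\ cand s b = true /\
        forall c, c < z -> cand s c = true -> R c b).
    { intros z s. unfold next. cbv zeta.
      match goal with |- context [bmin z ?q] =>
        destruct (bmin_spec z q) as [[B1 [B2 _]]|[B1 _]] end.
      - rewrite (proj2 (Nat.ltb_lt _ _) B1). right. eexists. split; [reflexivity|].
        apply andb_true_iff in B2. destruct B2 as [B2 B3]. split; [exact B2|].
        intros c Hc Hcc. rewrite ball_spec in B3. specialize (B3 c Hc).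
        rewrite Hcc in B3. simpl in B3. now apply asb_true in B3.
      - rewrite B1, Nat.ltb_irrefl. auto. }
    assert (Hnext' : forall z s b, b < z -> cand s b = true -> next z s <> 0).
    { intros z s b Hb Hcb. unfold next. cbv zeta.
      match goal with |- context [bmin z ?q] =>
        destruct (bmin_spec z q) as [[B1 _]|[_ B2]] end.
      - rewrite (proj2 (Nat.ltb_lt _ _) B1). lia.
      - exfalso. destruct (finite_max R (fun b => cand s b = true) z) as [m [M1 [M2 M3]]].
        + exact R3.
        + intros a c Ha Hc. apply Hcand in Ha. apply Hcand in Hc. apply R4; [apply Ha|apply Hc].
        + now exists b.
        + specialize (B2 m M1). rewrite M2 in B2. simpl in B2.
          apply not_true_iff_false in B2. apply B2. apply ball_spec. intros c Hc.
          destruct (cand s c) eqn:E; auto. simpl. apply true_asb. auto. }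
    assert (Hstop : forall Z, exists i, st Z i = 0).
    { intros Z. apply NNPP. intros Hno.
      assert (Hd : forall b i, st Z (S i) = b + 2 -> False).
      { intros b. induction b as [b IH] using (well_founded_induction R5). intros i Hi.
        destruct (Hnext (elt Z (S i)) (st Z (S i))) as [H|[c [H1 [H3 _]]]].
        - apply Hno. exists (S (S i)). exact H.
        - apply Hcand in H3. destruct H3 as [_ [H3|[d [H3 [H4 H5]]]]]; [lia|].
          assert (d = b) as -> by lia.
          apply (IH c (conj H4 H5) (S i)). exact H1. }
      destruct (Hnext (elt Z 0) 1) as [H|[c [H1 _]]].
      - apply Hno. exists 1. exact H.
      - apply (Hd c 0). exact H1. }
    assert (HS1 : forall S, subset S C2 -> subset S C).
    { intros S H. now apply subset_trans with C2. }
    apply uniformly_computes_intro with C2 (fun S n =>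
      let Z := tail S (nx S n) in O n (first (elt Z) (stop n Z))); auto.
    + set (Cl := fun S => set_infinite S /\ subset S C2).
      assert (Clinf : forall X, Cl X -> set_infinite X) by (intros X HX; apply HX).
      assert (Helt : forall n t i, comp Cl n t -> comp Cl n i ->
        comp Cl n (fun X v => elt (tail X (t X v)) (i X v))).
      { intros n t i. apply (comp_app2 Cl n (fun X t i => elt (tail X t) i)).
        unfold elt. comp_auto. }
      assert (Hfst : forall n t i, comp Cl n t -> comp Cl n i ->
        comp Cl n (fun X v => first (elt (tail X (t X v))) (i X v))).
      { intros n t i. apply (comp_app2 Cl n (fun X t i => first (elt (tail X t)) i)).
        unfold first. comp_auto. }
      assert (Hnx : forall n z s, comp Cl n z -> comp Cl n s ->
        comp Cl n (fun X v => next (z X v) (s X v))).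
      { intros n z s. apply (comp_app2 Cl n (fun X z s => next z s)).
        unfold next, cand. cbv zeta. comp_auto. }
      assert (Hst : forall n t i, comp Cl n t -> comp Cl n i ->
        comp Cl n (fun X v => st (tail X (t X v)) (i X v))).
      { intros n t i. apply (comp_app2 Cl n (fun X t i => st (tail X t) i)).
        unfold st. comp_auto. }
      assert (Hsp : forall n x t, comp Cl n x -> comp Cl n t ->
        comp Cl n (fun X v => stop (x X v) (tail X (t X v)))).
      { intros n x t. apply (comp_app2 Cl n (fun X x t => stop x (tail X t))).
        apply comp_mu with (p := fun X v i => (st (tail X (nth 1 v 0)) i =? 0) ||
          O (nth 0 v 0) (first (elt (tail X (nth 1 v 0))) i)).
        - cbv beta. comp_auto.
        - intros X v _ _. destruct (Hstop (tail X (nth 1 v 0))) as [i Hi].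
          exists i. now rewrite Hi. }
      cbv zeta. comp_auto.
    + intros S n HS HSC2. cbv zeta. set (k := nx S n). set (Z := tail S k).
      destruct (nx_spec S n HS) as [K1 [K2 _]]. fold k in K1, K2.
      assert (HZ : set_infinite Z) by now apply tail_infinite.
      assert (HZS : forall i, k < elt Z i /\ S (elt Z i) = true).
      { intros i. apply tail_spec. now apply elt_in. }
      assert (Hinc : increasing (elt Z)) by now apply elt_increasing.
      destruct (A n) eqn:Hn.
      * destruct (mu_spec (fun i => (st Z i =? 0) || O n (first (elt Z) i))) as [M1 M2].
        { destruct (Hstop Z) as [i Hi]. exists i. now rewrite Hi. }
        fold (stop n Z) in M1, M2. apply orb_true_iff in M1. destruct M1 as [M1|M1]; [|auto].
        apply Nat.eqb_eq in M1.
        set (rho := fun i => f (first (elt Z) i + 2 ^ n)).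
        assert (Hev : forall i, evn (elt Z i) B e [n] <> 0 /\ rho i < elt Z i).
        (* The empty set is handled at [k]; afterwards a set with elements up to [elt Z i] has its
           name below the next element. *)
        { intros i. destruct i as [|i].
          - apply (H2 k (HSC2 _ K2) n); auto; [lia|apply Nat.neq_0_lt_0, Nat.pow_nonzero; lia|].
            apply tail_spec. split; [apply HZS|apply HSC2, HZS].
          - destruct (HZS i) as [Z1 Z2].
            apply (H2 (elt Z i) (HSC2 _ Z2) n); auto; [lia| |].
            + change (first (elt Z) (Datatypes.S i)) with (first (elt Z) i + 2 ^ elt Z i).
              generalize (first_lt (elt Z) i Hinc). rewrite Nat.pow_succ_r'. lia.
            + apply tail_spec. split; [apply Hinc|apply HSC2, HZS]. }
        assert (Hbits : forall i x, Nat.testbit (first (elt Z) i) x = true ->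
          n < x /\ B x = true /\ evn x B e [n] <> 0).
        { intros i x Hx. apply testbit_first in Hx; auto. destruct Hx as [j [_ ->]].
          destruct (HZS j) as [Z1 Z2]. split; [lia|]. split; [|apply Hev].
          apply CB, (HS1 S); auto. }
        assert (Hnode : forall i, O n (first (elt Z) i) = false ->
          node B (first (elt Z) i + 2 ^ n) = true).
        { intros i Hi. apply node_spec. exists n, (first (elt Z) i). split; [auto|].
          split; [apply Hbits|]. split; [|auto].
          apply Kmono with (mask C (elt Z i)); [|apply CK].
          apply bsub_to_mask. intros x Hx. apply testbit_first in Hx; auto.
          destruct Hx as [j [Hj ->]]. split; [now apply increasing_lt|].
          apply (HS1 S); auto. apply HZS. }
        assert (Hrho : forall i, O n (first (elt Z) i) = false -> R (rho i) (rho i)).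
        { intros i Hi. apply Hf1. split; [|split]; auto. }
        assert (Hdec : forall i, O n (first (elt Z) i) = false ->
          O n (first (elt Z) (Datatypes.S i)) = false ->
          R (rho (Datatypes.S i)) (rho i) /\ rho (Datatypes.S i) <> rho i).
        { intros i H3 H4.
          (* Adding an element on top makes the set smaller in [lexlt], as for extensions in the
             Kleene-Brouwer order. *)
          assert (Hlex : lexlt (first (elt Z) (Datatypes.S i) + 2 ^ n)
                               (first (elt Z) i + 2 ^ n) = true).
          { apply lexlt_spec. exists (elt Z i).
            assert (Hb : forall j x, Nat.testbit (first (elt Z) j + 2 ^ n) x =
               if x =? n then true else Nat.testbit (first (elt Z) j) x).
            { intros j x. apply node_bits. intros y Hy. now apply (Hbits j). }
            assert (Hs : forall x, Nat.testbit (first (elt Z) (Datatypes.S i)) x =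
               if x =? elt Z i then true else Nat.testbit (first (elt Z) i) x).
            { intros x. apply testbit_pow2_add. now apply first_lt. }
            destruct (HZS i) as [Z1 _].
            split; [|split].
            - now rewrite Hb, Hs, Nat.eqb_refl, (proj2 (Nat.eqb_neq (elt Z i) n)) by lia.
            - rewrite Hb, (proj2 (Nat.eqb_neq (elt Z i) n)) by lia.
              apply testbit_high with (elt Z i); [now apply first_lt|lia].
            - intros y Hy. rewrite !Hb, Hs.
              now rewrite (proj2 (Nat.eqb_neq y (elt Z i))) by lia. }
          assert (Hfi : forall i, O n (first (elt Z) i) = false ->
            field tree_order (first (elt Z) i + 2 ^ n)).
          { intros j Hj. split; [|split]; auto. }
          assert (HRi : R (rho (Datatypes.S i)) (rho i)).
          { apply Hf2; auto. split; [|split]; auto. }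
          split; [exact HRi|]. intros E.
          assert (HT : tree_order (first (elt Z) i + 2 ^ n)
                                  (first (elt Z) (Datatypes.S i) + 2 ^ n)).
          { apply Hf2; auto. fold (rho i) (rho (Datatypes.S i)). rewrite E. auto. }
          destruct HT as [_ [_ [HT|HT]]].
          - rewrite HT, lexlt_irrefl in Hlex. discriminate.
          - generalize (lexlt_trans _ _ _ Hlex HT). rewrite lexlt_irrefl. discriminate. }
        (* The greedy value stays [R]-above [rho]: as [rho i] is a candidate below [elt Z i], the
           greatest candidate is at least as large. Hence the descent cannot end before a witness
           appears. *)
        assert (Hmain : forall i, i <= stop n Z ->
          (forall j, j < i -> O n (first (elt Z) j) = false) ->
          match i with
          | 0 => st Z 0 = 1
          | Datatypes.S j => exists b, st Z i = b + 2 /\ R (rho j) b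
          end).
        { induction i as [|i IH]; intros Hi Ho; [reflexivity|].
          assert (Hc : cand (st Z i) (rho i) = true).
          { apply Hcand. split; [apply Hrho, Ho; lia|].
            specialize (IH ltac:(lia) (fun j Hj => Ho j (Nat.lt_lt_succ_r _ _ Hj))).
            destruct i as [|i]; [auto|]. right. destruct IH as [b [IH1 IH2]].
            exists b. split; [auto|].
            destruct (Hdec i) as [D1 D2]; [apply Ho; lia|apply Ho; lia|].
            split; [now apply R3 with (rho i)|]. intros <-. apply D2. now apply R2. }
          destruct (Hnext (elt Z i) (st Z i)) as [H|[b [H3 [_ H4]]]].
          - exfalso. apply (Hnext' (elt Z i) (st Z i) (rho i)); auto. apply Hev.
          - exists b. split; [exact H3|]. apply H4; auto. apply Hev. }
        specialize (Hmain (stop n Z) (le_n _)).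
        destruct (stop n Z) as [|i] eqn:Es.
        -- rewrite Hmain in M1; [discriminate|lia].
        -- destruct Hmain as [b [Hb _]]; [|lia].
           intros j Hj. specialize (M2 j Hj). now apply orb_false_iff in M2.
      * apply not_true_is_false. intros E. apply Osound in E; [congruence|].
        intros x Hx. apply testbit_first in Hx; auto. destruct Hx as [j [_ ->]].
        apply (HS1 S); auto. apply HZS.
Qed.

End CaseA.

Theorem theorem1p5 (A B : nat -> bool) :
  set_infinite B ->
  (forall S, set_infinite S -> subset S B -> ce_in S A) ->
  (omega1_eq_ck B \/
   (set_infinite A /\ forall S, set_infinite S -> subset S A -> ce_in S A)) ->
  exists C : nat -> bool,
    set_infinite C /\ subset C B /\
    exists Phi : code, forall S, set_infinite S -> subset S C -> computes S Phi A.
Proof.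
  intros HB Hce Hcase.
  destruct (uniform_enumeration A B HB Hce)
    as [O [K [C [Ocomp [Kcomp [Omono [Kmono [Cinf [CB [CK [Osound Ocomplete]]]]]]]]]]].
  assert (H : uniformly_computes A C).
  { destruct Hcase as [Hck|[Ainf Ace]].
    (* [B] itself enumerates [A]; this [e] provides the certificates in [node]. *)
    - destruct (Hce B HB (subset_refl B)) as [e He].
      exact (case_a A B C O K Ocomp Kcomp Omono Kmono Cinf CB CK Osound Ocomplete e He Hck).
    - apply (case_b A C O Ocomp Omono Cinf Osound); auto.
      intros X HX HXC. apply Ocomplete; auto.
      + now apply subset_trans with C.
      + intros v. apply Kmono with (mask C v); auto. apply bsub_mask. auto. }
  destruct H as [D [D1 [D2 [Phi HPhi]]]]. exists D. split; [auto|].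
  split; [now apply subset_trans with C|]. now exists Phi.
Qed.
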